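(* Let $\ell=\pi$, $\gamma>0$, $c_0>0$, $m>0$ and $e_0>0$. Then there exist constants $\delta_0>0$ and $C>0$, depending on $\gamma$, $c_0$, $e_0$ and $m$, such that the following holds for all $0<\delta<\delta_0$ and all $T>0$. Let $H$ be a solution of $$H_t+\gamma\,\mathrm{div}\bigl(H^3\nabla(\Delta H+H)\bigr)=\delta\bigl(H^3\cos(\vartheta+t)\bigr)_\vartheta,\qquad \vartheta,\zeta\in\mathbb T,$$ on $[0,T]$ with initial value $H(0)=h_0$ of mean value $m$ and energy $E[h_0]=e_0$, and suppose that $H$ remains bounded away from zero on $[0,T]$: $$H(t,\vartheta,\zeta)\ge c_0>0\qquad\text{for all }0\le t\le T,\ \vartheta,\zeta\in\mathbb T.$$ Then for all $0\le t\le T$, $$\mathrm{dist}_{H^1}(H(t),\mathcal M)\le2\pi\sqrt3\,\mathrm{dist}_{H^1}(h_0,\mathcal M)\,e^{-\gamma c_0^3t}+C\delta.$$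
   Context: $\mathbb T=\mathbb R/2\pi\mathbb Z$; $\mathrm{div},\nabla,\Delta$ are the usual operators in $(\vartheta,\zeta)\in\mathbb T^2$. Fourier coefficients are $v_{k,l}=\frac1{4\pi^2}\int_{\mathbb T^2}v\,e^{-ik\vartheta}e^{-il\zeta}\,d\vartheta\,d\zeta$ and the mean value of $v$ is $v_{0,0}$. $L_{2,\mathrm{ev}}(\mathbb T^2)$ is the space of real-valued $v\in L_2(\mathbb T^2)$ even in $\zeta$ ($v_{k,l}=v_{k,-l}$), and $H^s_{\mathrm{ev}}(\mathbb T^2)$ the subspace with $\|v\|_{H^s}^2=\sum_{k,l}(1+k^2+l^2)^s|v_{k,l}|^2<\infty$. The energy of a function $H$ of mean value $m$ is $E[H]=\frac12\int_{\mathbb T^2}(|\nabla H|^2-|H|^2)\,d\vartheta\,d\zeta+2\pi^2m^2$ (a non-negative quantity). $\mathcal M=\mathcal M(m)=\{m+a_{-1}e^{-i\vartheta}+a_1e^{i\vartheta}+b\cos(\zeta):a_{\pm1}\in\mathbb C,\ b\in\mathbb R,\ a_{-1}=\overline{a_1},\ |a_{-1}|+|a_1|+|b|<m\}$. $P_1$ denotes the orthogonal projection of $L_{2,\mathrm{ev}}(\mathbb T^2)$ onto $\mathrm{span}\{e^{\pm i\vartheta},\cos\zeta\}$, and $P_{\ge2}h=h-m-P_1h$ for $h$ of mean value $m$. The point $m+P_1h$ is regarded as the closest point to $h$ on $\mathcal M$, so that $\mathrm{dist}_{H^1}(h,\mathcal M)=\|P_{\ge2}h\|_{H^1}$. Solutions: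 the equation is obtained from the rimming-flow equation $h_t+h_\theta+\gamma\,\mathrm{div}(h^3\nabla(\Delta h+h))=\delta(h^3\cos\theta)_\theta$ by $H(t,\vartheta,\zeta)=h(t,\vartheta+t,\zeta)$. Solutions are positive functions such that, for some $3<\alpha<4$, $h$ is continuous in time up to $t=0$ with values in $H^\alpha_{\mathrm{ev}}(\mathbb T^2)$, continuously differentiable for $t>0$ with values in $L_{2,\mathrm{ev}}(\mathbb T^2)$, and $h(t)\in H^4_{\mathrm{ev}}(\mathbb T^2)$ for $t>0$. *)

(* Defs.v *)
From HB Require Import structures.
From mathcomp Require Import all_boot all_order all_algebra.
From mathcomp Require Import complex.
From mathcomp Require Import all_classical all_reals all_analysis.
From mathcomp Require Import ring lra.
Set Implicit Arguments.
Unset Strict Implicit.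
Unset Printing Implicit Defensive.
Import Order.TTheory GRing.Theory Num.Theory.
Import numFieldNormedType.Exports.
Local Open Scope classical_set_scope.
Local Open Scope ring_scope.
Local Open Scope complex_scope.

(* Functions on the torus T^2 = (R / 2 pi Z)^2 are functions [v : R * R -> R]
   that are 2 pi-periodic in each variable; [x.1] is theta and [x.2] is zeta.
   All integrals over T^2 are Lebesgue integrals over the period square. *)
Definition periodic2 (R : realType) (v : R * R -> R) : Prop :=
  forall x : R * R, v (x.1 + 2 * pi, x.2) = v x /\ v (x.1, x.2 + 2 * pi) = v x.

Definition mu2 (R : realType) :
    {measure set (measurableTypeR R * measurableTypeR R) -> \bar R} :=
  (@lebesgue_measure R \x @lebesgue_measure R)%E.

Definition square (R : realType) : set (R * R) :=
  `[0, 2 * pi]%classic `*` `[0, 2 * pi]%classic.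

Definition intT2 (R : realType) (f : R * R -> R) : R :=
  \int[@mu2 R]_(x in @square R) f x.

(* The (possibly infinite) integral of v^2 over T^2. *)
Definition L2sqnorm (R : realType) (v : R * R -> R) : \bar R :=
  (\int[@mu2 R]_(x in @square R) ((v x ^+ 2)%:E))%E.

Definition L2T2 (R : realType) (v : R * R -> R) : Prop :=
  [/\ periodic2 v,
      measurable_fun (setT : set (measurableTypeR R * measurableTypeR R)) v &
      (L2sqnorm v < +oo)%E].

Definition expi (R : realType) (y : R) : R[i] := cos y +i* sin y.

Definition cintT2 (R : realType) (f : R * R -> R[i]) : R[i] :=
  intT2 (fun x => complex.Re (f x)) +i* intT2 (fun x => complex.Im (f x)).

Definition fourier (R : realType) (v : R * R -> R) (k l : int) : R[i] :=
  ((4 * pi ^+ 2)^-1)%:C *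
  cintT2 (fun x => (v x)%:C * expi (- (k%:~R * x.1)) * expi (- (l%:~R * x.2))).

Definition mean (R : realType) (v : R * R -> R) : R :=
  complex.Re (fourier v 0 0).

Definition L2ev (R : realType) (v : R * R -> R) : Prop :=
  L2T2 v /\ forall k l : int, fourier v k l = fourier v k (- l).

Definition Hsqnorm (R : realType) (s : R) (v : R * R -> R) : \bar R :=
  (\esum_(p in [set: int * int])
     (((1 + p.1%:~R ^+ 2 + p.2%:~R ^+ 2) `^ s
        * Normc.normc (fourier v p.1 p.2) ^+ 2)%:E))%E.

Definition Hev (R : realType) (s : R) (v : R * R -> R) : Prop :=
  L2ev v /\ (Hsqnorm s v < +oo)%E.

Definition Hnorm (R : realType) (s : R) (v : R * R -> R) : R :=
  Num.sqrt (fine (Hsqnorm s v)).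

(* Partial derivatives in the L_2 sense.  The Fourier identities express
   integration by parts against the test functions e^{-ik theta - il zeta};
   the derivative is unique up to null sets, hence a relation. *)
Definition is_dtheta (R : realType) (v w : R * R -> R) : Prop :=
  [/\ L2T2 v, L2T2 w &
      forall k l : int, fourier w k l = (0 +i* 1) * k%:~R * fourier v k l].

Definition is_dzeta (R : realType) (v w : R * R -> R) : Prop :=
  [/\ L2T2 v, L2T2 w &
      forall k l : int, fourier w k l = (0 +i* 1) * l%:~R * fourier v k l].

Definition is_grad (R : realType) (v g1 g2 : R * R -> R) : Prop :=
  is_dtheta v g1 /\ is_dzeta v g2.

Definition is_div (R : realType) (F1 F2 w : R * R -> R) : Prop :=
  exists a b : R * R -> R,
    [/\ is_dtheta F1 a, is_dzeta F2 b & w = (fun x => a x + b x)].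

Definition is_laplacian (R : realType) (v w : R * R -> R) : Prop :=
  exists g1 g2 : R * R -> R, is_grad v g1 g2 /\ is_div g1 g2 w.

(* [has_energy v e] means E[v] = e. *)
Definition has_energy (R : realType) (v : R * R -> R) (e : R) : Prop :=
  exists g1 g2 : R * R -> R,
    is_grad v g1 g2 /\
    e = 2^-1 * intT2 (fun x => g1 x ^+ 2 + g2 x ^+ 2 - v x ^+ 2)
        + 2 * pi ^+ 2 * mean v ^+ 2.

(* [pde gamma delta t u ut]: the equation
     u_t + gamma div (u^3 grad (Delta u + u))
       = delta (u^3 cos (theta + t))_theta
   holds in L_2(T^2) at time t, where [ut] stands for u_t. *)
Definition pde (R : realType) (gamma delta t : R) (u ut : R * R -> R) : Prop :=
  exists lap p1 p2 d s : R * R -> R,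
    [/\ is_laplacian u lap,
        is_grad (fun x => lap x + u x) p1 p2,
        is_div (fun x => u x ^+ 3 * p1 x) (fun x => u x ^+ 3 * p2 x) d,
        is_dtheta (fun x => u x ^+ 3 * cos (x.1 + t)) s &
        {ae @mu2 R, forall x, square x -> ut x + gamma * d x = delta * s x}].

(* H lies in C([0,T]; H^alpha_ev) and C^1((0,T]; L_{2,ev}); squared norms are
   kept extended-real-valued so that convergence to 0 cannot hold by a default
   value.  H t need not be the continuous representative of its class. *)
Definition is_solution (R : realType) (gamma delta T : R)
    (H : R -> R * R -> R) : Prop :=
  [/\ forall t x, 0 <= t <= T -> 0 < H t x,
      exists alpha : R, [/\ 3 < alpha < 4,
        forall t, 0 <= t <= T -> Hev alpha (H t) &
        forall t, 0 <= t <= T ->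
          Hsqnorm alpha (fun x => H s x - H t x)
            @[s --> within `[0, T]%classic (nbhs t)] --> 0%E],
      forall t, 0 < t <= T -> Hev 4 (H t) &
      exists Ht : R -> R * R -> R,
        [/\ forall t, 0 < t <= T -> L2ev (Ht t),
            forall t, 0 < t <= T ->
              L2sqnorm (fun x => (H s x - H t x) / (s - t) - Ht t x)
                @[s --> within `]0, T]%classic (dnbhs t)] --> 0%E,
            forall t, 0 < t <= T ->
              L2sqnorm (fun x => Ht s x - Ht t x)
                @[s --> within `]0, T]%classic (nbhs t)] --> 0%E &
            forall t, 0 < t <= T -> pde gamma delta t (H t) (Ht t)]].

Definition steady (R : realType) (m : R) : set (R * R -> R) :=
  [set g | exists (am1 a1 : R[i]) (b : R),
    [/\ am1 = a1^*,
        Normc.normc am1 + Normc.normc a1 + `|b| < m &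
        forall x, (g x)%:C = m%:C + am1 * expi (- x.1) + a1 * expi x.1
                             + (b * cos x.2)%:C]].

Definition dotT2 (R : realType) (f g : R * R -> R) : R :=
  intT2 (fun x => f x * g x).

Definition projline (R : realType) (e h : R * R -> R) : R * R -> R :=
  fun x => dotT2 h e / dotT2 e e * e x.

(* The orthogonal projection onto span {e^{i theta}, e^{-i theta}, cos zeta},
   computed for real-valued functions in the orthogonal basis
   cos theta, sin theta, cos zeta. *)
Definition P1 (R : realType) (h : R * R -> R) : R * R -> R :=
  fun x => projline (fun y => cos y.1) h x + projline (fun y => sin y.1) h x
           + projline (fun y => cos y.2) h x.

Definition Pge2 (R : realType) (m : R) (h : R * R -> R) : R * R -> R :=
  fun x => h x - m - P1 h x.

(* dist_{H^1}(h, M(m)) for h of mean value m: by convention the point of M(m)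
   closest to h is m + P_1 h, which lies on M(m) when its coefficients are small
   enough (see [closest_steady]). *)
Definition distH1_steady (R : realType) (m : R) (h : R * R -> R) : R :=
  Hnorm 1 (Pge2 m h).

Lemma closest_steady (R : realType) (m : R) (h : R * R -> R) :
  let A := dotT2 h (fun y => cos y.1)
           / dotT2 (fun y => cos y.1) (fun y => cos y.1) in
  let B := dotT2 h (fun y => sin y.1)
           / dotT2 (fun y => sin y.1) (fun y => sin y.1) in
  let b := dotT2 h (fun y => cos y.2)
           / dotT2 (fun y => cos y.2) (fun y => cos y.2) in
  Num.sqrt (A ^+ 2 + B ^+ 2) + `|b| < m ->
  steady m (fun x => m + P1 h x).
Proof.
move=> A B b Hlt.
have e : forall c d : R, Normc.normc ((c / 2) +i* (d / 2))
    = Num.sqrt (c ^+ 2 + d ^+ 2) / 2.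
  move=> c d; rewrite /= !expr_div_n -mulrDl sqrtrM ?addr_ge0 ?sqr_ge0//.
  by rewrite sqrtrV ?sqr_ge0// sqrtr_sqr ger0_norm.
exists ((A / 2) +i* (B / 2)), ((A / 2) +i* (- B / 2)), b; split.
- by rewrite /= mulNr opprK.
- by rewrite !e sqrrN -splitr.
- move=> x; apply/eqP; rewrite eq_complex /= /P1 /projline -/A -/B -/b.
  by rewrite cosN sinN; apply/andP; split; apply/eqP; field.
Qed.

(* Main.v *)
Require Import Defs.
From HB Require Import structures.
From mathcomp Require Import all_boot all_order all_algebra.
From mathcomp Require Import complex.
From mathcomp Require Import all_classical all_reals all_analysis.
From mathcomp Require Import measurable_realfun.
From mathcomp Require Import zify ring lra.
Set Implicit Arguments.
Unset Strict Implicit.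
Unset Printing Implicit Defensive.
Import Order.TTheory GRing.Theory Num.Theory.
Import numFieldNormedType.Exports.
Local Open Scope classical_set_scope.
Local Open Scope ring_scope.

(** The energy E of H is, up to the factor 2 pi^2, the sum of (lam - 1) |H_p|^2
    over the frequencies p = (k, l) with lam = k^2 + l^2 >= 2: the term
    2 pi^2 m^2 of E cancels the mean, and the four modes with lam = 1 carry the
    weight 0.  Since lam - 1 <= lam + 1 <= 3 (lam - 1) for lam >= 2, the energy is
    comparable to the squared H^1 distance to the steady states
    ([distH1_sqr_le], [energy_le_distH1]), so that it suffices to show that E
    decays at the rate 2 gamma c0^3 up to an error of order delta^2.

    Write q = Delta H + H.  Then E' = - (q, H_t), and integrating the equation
    by parts gives
      E' = - gamma int H^3 |grad q|^2 + delta int H^3 q_theta cos (theta + t).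
    As H >= c0, the first term is at most - gamma c0^3 D with
    D = int |grad q|^2, and D >= 4 E because lam (lam - 1) >= 2 for lam >= 2
    ([coercive]).  By Young's inequality the forcing costs a quarter of the
    dissipation and delta^2 / gamma times int H^3 cos^2.  This last integral is
    bounded by (sum_p |H_p|)^2 int H, where |H_p| <= m for every p since
    H > 0 has mean m, while sum_(lam >= 2) |H_p| is controlled by the square root
    of D, because the weights 1 / (lam (lam - 1)^2) are summable
    ([int_cubic_le]).  Thus int H^3 cos^2 <= K (m^3 + m D) and for small delta
    the term with D is again absorbed; what remains is
      E' <= - 2 gamma c0^3 E + K' delta^2    ([energy_dissipation]),
    with no bound on E needed, and Gronwall's inequality concludes.

    All the operators are defined by their Fourier coefficients, so these
    computations rest on Parseval's identity on the torus ([Parseval]), that is,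
    on the density of the trigonometric polynomials in L_2
    ([trigpoly_dense]).  The density is obtained from an explicit polynomial
    approximation of the sign function and from a sigma-algebra argument.  In
    time, H is only differentiable with values in L_2, but continuous with values
    in a space smaller than H^3; by the symmetry of Delta + 1,
    E(s) - E(t) = - (q(s) + q(t), H(s) - H(t)) / 2, which pairs a continuous
    function of s with a difference quotient that converges
    ([is_derive_energy]). *)

(** * Square-integrable functions on a measured set *)

Section SquareIntegrable.
Context (d : measure_display) (T : measurableType d) (R : realType).
Variables (mu : {measure set T -> \bar R}) (D : set T).
Hypothesis mD : measurable D.
Implicit Types f g h : T -> R.

Definition sqint f : Prop :=
  measurable_fun D f /\ mu.-integrable D (fun x => (f x ^+ 2)%:E).

Definition ip f g : R := \int[mu]_(x in D) (f x * g x).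

Lemma sqintP f : measurable_fun D f ->
  (\int[mu]_(x in D) (f x ^+ 2)%:E < +oo)%E -> sqint f.
Proof.
move=> mf lf; split => //; apply/integrableP; split.
  by apply/measurable_EFinP; exact: measurable_funX.
rewrite (eq_integral (fun x => (f x ^+ 2)%:E))// => x _.
by rewrite gee0_abs// lee_fin sqr_ge0.
Qed.

Lemma integral_sqr f : sqint f ->
  (\int[mu]_(x in D) (f x ^+ 2)%:E)%E = (ip f f)%:E.
Proof.
case=> mf If; rewrite /ip /Rintegral.
rewrite (eq_integral (fun x => (f x ^+ 2)%:E)); last by move=> x _; rewrite expr2.
by rewrite fineK//; apply: integrable_fin_num.
Qed.

Lemma integrable_mul f g : sqint f -> sqint g ->
  mu.-integrable D (EFin \o (fun x => f x * g x)).
Proof.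
move=> [mf If] [mg Ig].
have I : mu.-integrable D (EFin \o (fun x => f x ^+ 2 + g x ^+ 2)).
  by rewrite (_ : _ \o _ = (fun x => (f x ^+ 2)%:E) \+ (fun x => (g x ^+ 2)%:E))%E//;
     apply: integrableD.
apply: le_integrable I => //.
  by apply/measurable_EFinP; exact: measurable_funM.
move=> x Dx /=; rewrite lee_fin [leRHS]ger0_norm ?addr_ge0 ?sqr_ge0//.
rewrite normrM -(real_normK (num_real (f x))) -(real_normK (num_real (g x))).
by have := sqr_ge0 (`|f x| - `|g x|); have := sqr_ge0 (`|f x| + `|g x|); nra.
Qed.

Lemma sqint_dominated f g : sqint f -> measurable_fun D g ->
  (forall x, D x -> `|g x| <= `|f x|) -> sqint g.
Proof.
move=> [mf If] mg gf; split => //; apply: le_integrable If => //.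
  by apply/measurable_EFinP; exact: measurable_funX.
move=> x Dx /=; rewrite lee_fin !normrX.
by rewrite lerXn2r ?nnegrE//; exact: gf.
Qed.

Lemma sqintD f g : sqint f -> sqint g -> sqint (fun x => f x + g x).
Proof.
move=> sf sg; have Ifg := integrable_mul sf sg.
case: sf sg => mf If [mg Ig]; split; first exact: measurable_funD.
have -> : (fun x => ((f x + g x) ^+ 2)%:E) =
  ((fun x => (f x ^+ 2)%:E) \+ (fun x => (g x ^+ 2)%:E)
    \+ (fun x => 2%:E * (f x * g x)%:E))%E.
  by apply/funext => x /=; rewrite -EFinM -!EFinD; congr EFin; ring.
by do 2? apply: integrableD => //; exact: integrableZl.
Qed.

Lemma sqintZ c f : sqint f -> sqint (fun x => c * f x).
Proof.
case=> mf If; split; first exact: measurable_funM.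
have -> : (fun x => ((c * f x) ^+ 2)%:E) =
  (fun x => (c ^+ 2)%:E * (f x ^+ 2)%:E)%E.
  by apply/funext => x /=; rewrite -EFinM exprMn.
exact: integrableZl.
Qed.

Lemma sqintB f g : sqint f -> sqint g -> sqint (fun x => f x - g x).
Proof.
move=> sf sg; have := sqintD sf (sqintZ (-1) sg).
by congr sqint; apply/funext => x; rewrite mulN1r.
Qed.

Lemma sqint0 : sqint (fun=> 0).
Proof.
split; first exact: measurable_cst.
by rewrite (_ : (fun=> _) = cst 0%E) ?expr0n//; exact: integrable0.
Qed.

Lemma sqint_sum (I : Type) (s : seq I) (F : I -> T -> R) :
  (forall i, sqint (F i)) -> sqint (fun x => \sum_(i <- s) F i x).
Proof.
move=> sF; elim: s => [|i s IH].
  by under eq_fun do rewrite big_nil; exact: sqint0.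
by under eq_fun do rewrite big_cons; exact: sqintD.
Qed.

Lemma sqint_bounded_mul f g M : sqint f -> measurable_fun D g ->
  (forall x, D x -> `|g x| <= M) -> sqint (fun x => g x * f x).
Proof.
move=> sf mg gM; apply: (sqint_dominated (sqintZ `|M| sf)).
  by apply: measurable_funM => //; case: sf.
move=> x Dx; rewrite !normrM normr_id ler_wpM2r//.
by rewrite (le_trans (gM _ Dx))// ler_norm.
Qed.

Lemma ipC f g : ip f g = ip g f.
Proof. by rewrite /ip; under eq_Rintegral do rewrite mulrC. Qed.

Lemma ipDl f g h : sqint f -> sqint g -> sqint h ->
  ip (fun x => f x + g x) h = ip f h + ip g h.
Proof.
move=> sf sg sh; rewrite /ip -RintegralD//; try exact: integrable_mul.
by under eq_Rintegral do rewrite mulrDl.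
Qed.

Lemma ipZl c f h : sqint f -> sqint h ->
  ip (fun x => c * f x) h = c * ip f h.
Proof.
move=> sf sh; rewrite /ip -RintegralZl//; last exact: integrable_mul.
by under eq_Rintegral do rewrite -mulrA.
Qed.

Lemma ipBl f g h : sqint f -> sqint g -> sqint h ->
  ip (fun x => f x - g x) h = ip f h - ip g h.
Proof.
move=> sf sg sh; rewrite -mulN1r -ipZl// -ipDl//; last exact: sqintZ.
by congr ip; apply/funext => x; rewrite mulN1r.
Qed.

Lemma ipDr f g h : sqint f -> sqint g -> sqint h ->
  ip h (fun x => f x + g x) = ip h f + ip h g.
Proof. by move=> *; rewrite ipC ipDl// ![ip _ h]ipC. Qed.

Lemma ipZr c f h : sqint f -> sqint h ->
  ip h (fun x => c * f x) = c * ip h f.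
Proof. by move=> *; rewrite ipC ipZl// ipC. Qed.

Lemma ipBr f g h : sqint f -> sqint g -> sqint h ->
  ip h (fun x => f x - g x) = ip h f - ip h g.
Proof. by move=> *; rewrite ipC ipBl// ![ip _ h]ipC. Qed.

Lemma ip_suml (I : Type) (s : seq I) (F : I -> T -> R) h :
  (forall i, sqint (F i)) -> sqint h ->
  ip (fun x => \sum_(i <- s) F i x) h = \sum_(i <- s) ip (F i) h.
Proof.
move=> sF sh; elim: s => [|i s IH].
  under eq_fun do rewrite big_nil.
  rewrite big_nil /ip /Rintegral; under eq_integral do rewrite mul0r.
  by rewrite integral0.
under eq_fun do rewrite big_cons.
by rewrite big_cons ipDl// ?IH//; exact: sqint_sum.
Qed.

Lemma ip_ge0 f : 0 <= ip f f.
Proof. by apply: Rintegral_ge0 => x _; rewrite -expr2 sqr_ge0. Qed.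

Lemma ip_sqrD f g : sqint f -> sqint g ->
  ip (fun x => f x + g x) (fun x => f x + g x) = ip f f + 2 * ip f g + ip g g.
Proof.
move=> sf sg; have sfg := sqintD sf sg.
by rewrite ipDl// !ipDr// (ipC g f); ring.
Qed.

Lemma ip_sqrB f g : sqint f -> sqint g ->
  ip (fun x => f x - g x) (fun x => f x - g x) = ip f f - 2 * ip f g + ip g g.
Proof.
move=> sf sg; have sfg := sqintB sf sg.
by rewrite ipBl// !ipBr// (ipC g f); ring.
Qed.

Lemma Cauchy_Schwarz f g : sqint f -> sqint g ->
  ip f g ^+ 2 <= ip f f * ip g g.
Proof.
move=> sf sg.
have Q x : 0 <= ip f f - 2 * (x * ip f g) + x ^+ 2 * ip g g.
  have := ip_ge0 (fun y => f y - x * g y).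
  by rewrite ip_sqrB ?ipZr ?ipZl//; [congr (_ <= _); ring|
     exact: sqintZ|exact: sqintZ].
have [g0|g0] := eqVneq (ip g g) 0.
  (* without quadratic term, a suitable x would make [Q] negative *)
  rewrite g0 mulr0 real_exprn_even_le0 ?num_real//=; apply/eqP.
  apply/eqP; apply: contraT => fg0.
  have := Q ((ip f f + 1) / (2 * ip f g)); rewrite g0 mulr0 addr0.
  have -> : ip f f - 2 * ((ip f f + 1) / (2 * ip f g) * ip f g) = -1.
    by field.
  by rewrite ler0N1.
have gp : 0 < ip g g by rewrite lt_neqAle eq_sym g0 ip_ge0.
have := Q (ip f g / ip g g).
have -> : ip f f - 2 * (ip f g / ip g g * ip f g) + (ip f g / ip g g) ^+ 2 * ip g g
   = (ip f f * ip g g - ip f g ^+ 2) / ip g g by field.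
by rewrite pmulr_lge0 ?invr_gt0// subr_ge0.
Qed.

Lemma normr_ip f g : sqint f -> sqint g ->
  `|ip f g| <= Num.sqrt (ip f f) * Num.sqrt (ip g g).
Proof.
move=> sf sg; rewrite -sqrtrM ?ip_ge0// -sqrtr_sqr.
by rewrite ler_wsqrtr// Cauchy_Schwarz.
Qed.

(** Continuity of the pairing under mean-square convergence, along an
    arbitrary filter: expand around the limit and use Cauchy-Schwarz. *)
Lemma cvg_ip (X : Type) (F : set_system X) (FF : Filter F)
    (u v : X -> T -> R) (u0 v0 : T -> R) :
  (\forall s \near F, sqint (u s)) -> (\forall s \near F, sqint (v s)) ->
  sqint u0 -> sqint v0 ->
  ip (fun x => u s x - u0 x) (fun x => u s x - u0 x) @[s --> F] --> 0 ->
  ip (fun x => v s x - v0 x) (fun x => v s x - v0 x) @[s --> F] --> 0 ->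
  ip (u s) (v s) @[s --> F] --> ip u0 v0.
Proof.
move=> su sv su0 sv0 cu cv.
set a := fun s => ip (fun x => u s x - u0 x) (fun x => u s x - u0 x).
set b := fun s => ip (fun x => v s x - v0 x) (fun x => v s x - v0 x).
pose e s := Num.sqrt (a s) * Num.sqrt (b s) + Num.sqrt (ip u0 u0) * Num.sqrt (b s)
            + Num.sqrt (a s) * Num.sqrt (ip v0 v0).
have ce : e s @[s --> F] --> 0.
  rewrite (_ : 0 = Num.sqrt 0 * Num.sqrt 0 + Num.sqrt (ip u0 u0) * Num.sqrt 0
            + Num.sqrt 0 * Num.sqrt (ip v0 v0) :> R); last first.
    by rewrite sqrtr0 !mulr0 !mul0r !addr0.
  have ca : Num.sqrt (a s) @[s --> F] --> Num.sqrt 0.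
    by apply: continuous_cvg => //; exact: sqrt_continuous.
  have cb : Num.sqrt (b s) @[s --> F] --> Num.sqrt 0.
    by apply: continuous_cvg => //; exact: sqrt_continuous.
  by apply: cvgD; [apply: cvgD; apply: cvgM => //; exact: cvg_cst
                  |apply: cvgM => //; exact: cvg_cst].
suff C : `|ip (u s) (v s) - ip u0 v0| @[s --> F] --> (0 : R).
  exact: (proj1 (subr_cvg0 _ _) (norm_cvg0 C)).
apply: (squeeze_cvgr (f := fun=> 0) (h := e)); [|exact: cvg_cst|exact: ce].
near=> s; rewrite normr_ge0/=.
have us : sqint (u s) by near: s.
have vs : sqint (v s) by near: s.
have su' := sqintB us su0; have sv' := sqintB vs sv0.
have -> : ip (u s) (v s) - ip u0 v0 =
    ip (fun x => u s x - u0 x) (fun x => v s x - v0 x)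
    + ip u0 (fun x => v s x - v0 x) + ip (fun x => u s x - u0 x) v0.
  by rewrite !ipBl// !ipBr//; ring.
rewrite (le_trans (ler_normD _ _))// lerD ?normr_ip//.
by rewrite (le_trans (ler_normD _ _))// lerD ?normr_ip.
Unshelve. all: by end_near. Qed.

End SquareIntegrable.

(** * Trigonometric modes on the torus *)

Section TorusMeasure.
Variable R : realType.

Lemma measurable_square :
  measurable (@square R : set (measurableTypeR R * measurableTypeR R)).
Proof. by apply: measurableX; exact: measurable_itv. Qed.

Lemma mu2_rect (A B : set R) :
  @measurable _ (measurableTypeR R) A -> @measurable _ (measurableTypeR R) B ->
  @mu2 R (A `*` B) = (@lebesgue_measure R A * @lebesgue_measure R B)%E.
Proof. exact: product_measure1E. Qed.

Lemma mu2_square : @mu2 R (@square R) = (4 * pi ^+ 2)%:E.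
Proof.
rewrite mu2_rect; try exact: measurable_itv.
rewrite lebesgue_measure_itv/= lte_fin mulr_gt0 ?pi_gt0//.
by rewrite -EFinB -EFinM; congr EFin; ring.
Qed.

Lemma mu2_square_lty : (@mu2 R (@square R) < +oo)%E.
Proof. by rewrite mu2_square ltry. Qed.

End TorusMeasure.

Local Notation RR R := (measurableTypeR R * measurableTypeR R)%type.
Local Notation sq := (@square _).
Local Notation mu := (@mu2 _).
Local Notation mS := (@measurable_square _).
Local Notation L2 f := (sqint (@mu2 _) (@square _) f).
Local Notation dot f g := (ip (@mu2 _) (@square _) f g).

#[local] Hint Resolve measurable_square : core.

Section Modes.
Variable R : realType.
Implicit Types (f g : R * R -> R) (k l : int) (a : R).

(** One family for cosines (a = 0) and sines (a = pi / 2, up to the sign), closed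
    under products up to linear combinations. *)
Definition mode k l a (x : R * R) : R := cos (k%:~R * x.1 + l%:~R * x.2 + a).

Lemma cosDint (n : int) (y : R) : cos (y + n%:~R * (2 * pi)) = cos y.
Proof.
have pos (m : nat) z : cos (z + m%:R * (2 * pi)) = cos z :> R.
  rewrite -[RHS](periodicn (@cosD2pi R) m z); congr cos; congr (_ + _).
  by rewrite -[RHS]mulr_natl -[pi *+ 2]mulr_natl.
case: n => n; first exact: pos.
by rewrite -[LHS](pos n.+1) NegzE mulrNz mulNr subrK.
Qed.

Lemma continuous_mode1 c b : continuous (fun y : R => cos (c * y + b)).
Proof.
move=> y; apply: continuous_comp; last exact: continuous_cos.
by apply: cvgD; [apply: cvgM; [exact: cvg_cst|exact: cvg_id]|exact: cvg_cst].
Qed.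

Lemma integral_mode1 (l : int) (b : R) : l != 0 ->
  (\int[@lebesgue_measure R]_(y in `[0%R, (2 * pi)%R]) (cos (l%:~R * y + b))%:E = 0)%E.
Proof.
move=> l0; have lR : l%:~R != 0 :> R by rewrite intr_eq0.
pose F (y : R) := sin (l%:~R * y + b) / l%:~R.
have dF (y : R) : is_derive y (1 : R) F (cos (l%:~R * y + b)).
  rewrite /F; apply: is_derive_eq.
  rewrite /GRing.scale/=; field; exact: lR.
have cF : continuous F.
  by move=> y; apply/differentiable_continuous/derivable1_diffP; case: (dF y).
rewrite (@continuous_FTC2 _ _ F); first last.
- by move=> y _; rewrite derive1E; case: (dF y).
- split.
  + by move=> y _; case: (dF y).
  + exact/cvg_at_right_filter/cF.
  + exact/cvg_at_left_filter/cF.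
- by apply: continuous_subspaceT; exact: continuous_mode1.
- by rewrite mulr_gt0// pi_gt0.
rewrite -EFinB; congr EFin; apply/eqP; rewrite subr_eq0 /F; apply/eqP; congr (_ / _).
rewrite mulr0 add0r -!cosBpihalf -[RHS](cosDint l); congr cos; ring.
Qed.

Lemma measurable_mode D k l a :
  measurable_fun (D : set (measurableTypeR R * measurableTypeR R)) (mode k l a).
Proof.
apply: measurable_funTS; rewrite /mode.
apply: (@measurableT_comp _ _ _ _ _ _ (@cos R)) => //.
  by apply: continuous_measurable_fun; exact: continuous_cos.
apply: measurable_funD; last exact: measurable_cst.
by apply: measurable_funD; apply: measurable_funM => //; exact: measurable_cst.
Qed.

Lemma normr_mode k l a x : `|mode k l a x| <= 1.
Proof. exact: cos_max. Qed.

Lemma L2_bounded f M : measurable_fun sq f -> (forall x, sq x -> `|f x| <= M) ->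
  L2 f.
Proof.
move=> mf fM; split => //.
rewrite -[X in _.-integrable _ X]/(EFin \o (fun x => f x ^+ 2)).
apply: measurable_bounded_integrable.
- exact: mS.
- exact: (@mu2_square_lty R).
- exact: measurable_funX.
exists (M ^+ 2); split; first exact: num_real.
move=> y My x sx; apply: le_trans (ltW My); rewrite normrX.
by apply: lerXn2r; rewrite ?nnegrE ?fM// (le_trans _ (fM x sx)).
Qed.

Lemma L2_cst (c : R) : L2 (fun=> c : R).
Proof. by apply: (@L2_bounded _ `|c|); first exact: measurable_cst. Qed.

Lemma L2_mode k l a : L2 (mode k l a).
Proof.
by apply: (@L2_bounded _ 1); [exact: measurable_mode|move=> x _; exact: normr_mode].
Qed.

Lemma L2_integrable f : L2 f -> mu.-integrable sq (EFin \o f).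
Proof.
move=> Lf; have := integrable_mul mS Lf (L2_cst 1).
by congr (_.-integrable _ (EFin \o _)); apply/funext => x; rewrite mulr1.
Qed.

Lemma dot1 f : dot f (fun=> 1) = intT2 f.
Proof. by rewrite /ip /intT2; apply: eq_Rintegral => x _; rewrite mulr1. Qed.

(** The mode integrates to zero already in the variable that it really depends
    on, hence over the square by Fubini's theorem. *)
Lemma intT2_mode k l a :
  intT2 (mode k l a) = if (k == 0) && (l == 0) then 4 * pi ^+ 2 * cos a else 0.
Proof.
have [/andP[/eqP-> /eqP->]|] := ifPn.
  rewrite /intT2 (_ : mode 0 0 a = fun=> cos a); last first.
    by apply/funext => x; rewrite /mode !mulr0z !mul0r !add0r.
  rewrite Rintegral_cst; last exact: mS.
  by rewrite [mu2 R _]mu2_square/= mulrC.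
move=> kl.
have I : mu.-integrable setT ((EFin \o mode k l a) \_ sq).
  apply/(integrable_mkcond _ mS).1.
  exact/L2_integrable/L2_mode.
rewrite /intT2 /Rintegral integral_mkcond.
have patchE' x y : ((EFin \o mode k l a) \_ sq) (x, y) =
   if (x \in `[0, 2 * pi]%classic) && (y \in `[0, 2 * pi]%classic)
   then (mode k l a (x, y))%:E else 0%E.
  by rewrite patchE /square in_setX.
have [k0|k0] := eqVneq k 0.
  have l0 : l != 0 by move: kl; rewrite k0 eqxx.
  rewrite -(integral12_prod_meas1 I) integral0_eq// => x _.
  rewrite /fubini_F; have [xi|xi] := boolP (x \in `[0, 2 * pi]%classic); last first.
    by rewrite integral0_eq// => y _; rewrite patchE' (negbTE xi).
  rewrite -[RHS](@integral_mode1 l (k%:~R * x + a) l0) [RHS]integral_mkcond.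
  apply: eq_integral => y _; rewrite patchE' xi/= patchE.
  by case: ifP => // _; rewrite /mode/=; congr (cos _)%:E; ring.
rewrite -(integral21_prod_meas1 I) integral0_eq// => y _.
rewrite /fubini_G; have [yi|yi] := boolP (y \in `[0, 2 * pi]%classic); last first.
  by rewrite integral0_eq// => x _; rewrite patchE' (negbTE yi) andbF.
rewrite -[RHS](@integral_mode1 k (l%:~R * y + a) k0) [RHS]integral_mkcond.
apply: eq_integral => x _; rewrite patchE' yi/= andbT patchE.
by case: ifP => // _; rewrite /mode/=; congr (cos _)%:E; ring.
Qed.

Lemma modeM k l a k' l' a' x : mode k l a x * mode k' l' a' x =
  2^-1 * mode (k - k') (l - l') (a - a') x
  + 2^-1 * mode (k + k') (l + l') (a + a') x.
Proof.
rewrite /mode !(intrB, intrD).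
set u := k%:~R * x.1 + _ + a; set v := k'%:~R * x.1 + _ + a'.
rewrite (_ : _ + (a - a') = u - v); last by rewrite /u /v; ring.
rewrite (_ : _ + (a + a') = u + v); last by rewrite /u /v; ring.
by move: u v => u v; rewrite cosB cosD; field.
Qed.

Lemma dot_mode k l a k' l' a' :
  dot (mode k l a) (mode k' l' a') =
    2 * pi ^+ 2 * (if (k == k') && (l == l') then cos (a - a') else 0)
  + 2 * pi ^+ 2 * (if (k == - k') && (l == - l') then cos (a + a') else 0).
Proof.
have -> : dot (mode k l a) (mode k' l' a') =
    2^-1 * intT2 (mode (k - k') (l - l') (a - a'))
  + 2^-1 * intT2 (mode (k + k') (l + l') (a + a')).
  rewrite -!dot1 -!ipZl//; try exact: L2_mode; try exact: L2_cst; try exact: mS.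
  rewrite -ipDl//; try exact: mS; try exact: L2_cst;
    try (apply: sqintZ; [exact: mS|exact: L2_mode]).
  by rewrite dot1 /ip /intT2; apply: eq_Rintegral => x _; rewrite modeM.
rewrite !intT2_mode !subr_eq0 !addr_eq0.
by case: ifP => _; case: ifP => _; field.
Qed.

(** The span is taken inductively, so that closure properties are proved by
    induction and no coefficients have to be carried around. *)
Inductive trigpoly : (R * R -> R) -> Prop :=
| trigpoly_mode k l a : trigpoly (mode k l a)
| trigpolyD f g : trigpoly f -> trigpoly g -> trigpoly (fun x => f x + g x)
| trigpolyZ c f : trigpoly f -> trigpoly (fun x => c * f x).

Lemma trigpolyM f g : trigpoly f -> trigpoly g -> trigpoly (fun x => f x * g x).
Proof.
move=> tf tg; elim: tf => [k l a|f1 f2 _ h1 _ h2|c f1 _ h1].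
- elim: tg => [k' l' a'|g1 g2 _ h1 _ h2|c g1 _ h1].
  + under eq_fun do rewrite modeM.
    by apply: trigpolyD; apply: trigpolyZ; exact: trigpoly_mode.
  + by under eq_fun do rewrite mulrDr; exact: trigpolyD.
  + by under eq_fun do rewrite mulrCA; exact: trigpolyZ.
- by under eq_fun do rewrite mulrDl; exact: trigpolyD.
- by under eq_fun do rewrite -mulrA; exact: trigpolyZ.
Qed.

Lemma trigpoly_cst c : trigpoly (fun=> c).
Proof.
have -> : (fun=> c) = (fun x => c * mode 0 0 0 x).
  by apply/funext => x; rewrite /mode !mulr0z !mul0r !add0r cos0 mulr1.
exact/trigpolyZ/trigpoly_mode.
Qed.

Lemma trigpoly_bounded f : trigpoly f ->
  measurable_fun sq f /\ exists M, forall x, `|f x| <= M.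
Proof.
elim=> [k l a|f1 f2 _ [m1 [M1 h1]] _ [m2 [M2 h2]]|c f1 _ [m1 [M1 h1]]].
- by split; [exact: measurable_mode|exists 1 => x; exact: normr_mode].
- split; first exact: measurable_funD.
  exists (M1 + M2) => x; exact: le_trans (ler_normD _ _) (lerD (h1 x) (h2 x)).
- split; first by apply: measurable_funM => //; exact: measurable_cst.
  by exists (`|c| * M1) => x; rewrite normrM ler_wpM2l.
Qed.

Lemma L2_trigpoly f : trigpoly f -> L2 f.
Proof. by move=> /trigpoly_bounded[mf [M fM]]; exact: (@L2_bounded _ M). Qed.

End Modes.

(** * Density of trigonometric polynomials *)

Section Density.
Variable R : realType.
Implicit Types (f g : R * R -> R) (k l : int) (a : R).

Lemma dot_sqrD_le f g : L2 f -> L2 g ->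
  dot (fun x => f x + g x) (fun x => f x + g x) <= 2 * dot f f + 2 * dot g g.
Proof.
move=> Lf Lg; have := ip_ge0 mu sq (fun x => f x - g x).
by rewrite ip_sqrB// ip_sqrD//; lra.
Qed.

Lemma dot_bounded_mul f g M : L2 f -> measurable_fun (sq : set (RR R)) g ->
  (forall x, sq x -> `|g x| <= M) ->
  dot (fun x => g x * f x) (fun x => g x * f x) <= M ^+ 2 * dot f f.
Proof.
move=> Lf mg gM; have Lgf := sqint_bounded_mul mS Lf mg gM.
have LMf := sqintZ mS M Lf.
have -> : M ^+ 2 * dot f f = dot (fun x => M * f x) (fun x => M * f x).
  by rewrite ipZl// ipZr//; ring.
apply: le_Rintegral => //; try exact: integrable_mul.
move=> x sx; rewrite -!expr2 -(real_normK (num_real (g x * f x))).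
rewrite -(real_normK (num_real (M * f x))) lerXn2r ?nnegrE// !normrM ler_wpM2r//.
by rewrite (le_trans (gM _ sx))// ler_norm.
Qed.

Definition trig_approx f := L2 f /\ forall e, 0 < e -> exists2 p, trigpoly p &
  dot (fun x => f x - p x) (fun x => f x - p x) < e.

Lemma approx_trigpoly p : trigpoly p -> trig_approx p.
Proof.
move=> tp; split; first exact: L2_trigpoly.
move=> e e0; exists p => //; rewrite /ip /Rintegral integral0_eq// => x _.
by rewrite subrr mulr0.
Qed.

Lemma approx_lim f : L2 f ->
  (forall e, 0 < e -> exists2 g, trig_approx g &
     dot (fun x => f x - g x) (fun x => f x - g x) < e) -> trig_approx f.
Proof.
move=> Lf fg; split => // e e0.
have e4 : 0 < e / 4 by rewrite divr_gt0.
have [g [Lg gp] lg] := fg _ e4; have [p tp lp] := gp _ e4.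
exists p => //; have Lp := L2_trigpoly tp.
have := dot_sqrD_le (sqintB mS Lf Lg) (sqintB mS Lg Lp).
under [X in ip _ _ X _ <= _]eq_fun do rewrite subrKA.
under [X in ip _ _ _ X <= _]eq_fun do rewrite subrKA.
by move=> h; lra.
Qed.

Lemma approxD f g : trig_approx f -> trig_approx g -> trig_approx (fun x => f x + g x).
Proof.
move=> [Lf af] [Lg ag]; split; first exact: sqintD.
move=> e e0; have e4 : 0 < e / 4 by rewrite divr_gt0.
have [p tp lp] := af _ e4; have [q tq lq] := ag _ e4.
exists (fun x => p x + q x); first exact: trigpolyD.
have := dot_sqrD_le (sqintB mS Lf (L2_trigpoly tp)) (sqintB mS Lg (L2_trigpoly tq)).
under [X in ip _ _ X _ <= _]eq_fun do rewrite addrACA -opprD.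
under [X in ip _ _ _ X <= _]eq_fun do rewrite addrACA -opprD.
by move=> h; lra.
Qed.

(** Bounded approximable functions form an algebra: in f g - p q =
    f (g - q) + q (f - p) one chooses q first, which is bounded, and then p. *)
Lemma approxM f g M : trig_approx f -> trig_approx g -> (forall x, sq x -> `|f x| <= M) ->
  trig_approx (fun x => f x * g x).
Proof.
move=> [Lf af] [Lg ag] fM; split.
  by apply: (@sqint_bounded_mul _ _ _ _ _ _ _ _ M) => //; case: Lf.
move=> e e0.
have e1 : 0 < e / (4 * (M ^+ 2 + 1)).
  by rewrite divr_gt0// mulr_gt0// ltr_wpDl// sqr_ge0.
have [q tq lq] := ag _ e1; have [mq [Q qQ]] := trigpoly_bounded tq.
have e2 : 0 < e / (4 * (Q ^+ 2 + 1)).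
  by rewrite divr_gt0// mulr_gt0// ltr_wpDl// sqr_ge0.
have [p tp lp] := af _ e2.
exists (fun x => p x * q x); first exact: trigpolyM.
have Lp := L2_trigpoly tp; have Lq := L2_trigpoly tq.
have mf : measurable_fun (sq : set (RR R)) f by case: Lf.
have L1 := sqint_bounded_mul mS (sqintB mS Lg Lq) mf fM.
have L2' := sqint_bounded_mul mS (sqintB mS Lf Lp) mq (fun x _ => qQ x).
have := dot_sqrD_le L1 L2'.
have E x : f x * (g x - q x) + q x * (f x - p x) = f x * g x - p x * q x by ring.
under [X in ip _ _ X _ <= _]eq_fun do rewrite E.
under [X in ip _ _ _ X <= _]eq_fun do rewrite E.
move/le_lt_trans; apply.
have b1 := dot_bounded_mul (sqintB mS Lg Lq) mf fM.
have b2 := dot_bounded_mul (sqintB mS Lf Lp) mq (fun x _ => qQ x).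
have key (A G K : R) : A <= K ^+ 2 * G -> 0 <= G -> G < e / (4 * (K ^+ 2 + 1)) ->
    2 * A < e / 2.
  move=> h1 h2; rewrite ltr_pdivlMr; last by rewrite mulr_gt0// ltr_wpDl// sqr_ge0.
  by move=> h3; nra.
have k1 := key _ _ _ b1 (ip_ge0 _ _ _) lq.
have k2 := key _ _ _ b2 (ip_ge0 _ _ _) lp.
by rewrite [e]splitr ltrD.
Qed.

Lemma approx_cst c : trig_approx (fun=> c).
Proof. exact/approx_trigpoly/trigpoly_cst. Qed.

Lemma approxZ c f : trig_approx f -> trig_approx (fun x => c * f x).
Proof. by move=> af; apply: (approxM (approx_cst c) af) => x _; exact: lexx. Qed.

Lemma approxB f g : trig_approx f -> trig_approx g -> trig_approx (fun x => f x - g x).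
Proof.
move=> af ag; have := approxD af (approxZ (-1) ag).
by congr trig_approx; apply/funext => x; rewrite mulN1r.
Qed.

Lemma approx_sum (I : Type) (s : seq I) (F : I -> R * R -> R) :
  (forall i, trig_approx (F i)) -> trig_approx (fun x => \sum_(i <- s) F i x).
Proof.
move=> aF; elim: s => [|i s IH].
  by under eq_fun do rewrite big_nil; exact: approx_cst.
by under eq_fun do rewrite big_cons; exact: approxD.
Qed.

(** Dominated convergence turns pointwise limits into mean-square limits. *)
Lemma approx_dominated (F : nat -> R * R -> R) f g : (forall n, trig_approx (F n)) ->
  measurable_fun (sq : set (RR R)) f -> L2 g ->
  (forall n x, sq x -> `|F n x| <= g x) -> (forall x, sq x -> `|f x| <= g x) ->
  {ae mu, forall x, sq x -> F n x @[n --> \oo] --> f x} -> trig_approx f.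
Proof.
move=> aF mf Lg Fg fg Ff.
have Lf : L2 f.
  apply: (sqint_dominated mS Lg mf) => x sx.
  by rewrite (le_trans (fg _ sx))// ler_norm.
have LF n : L2 (F n) by case: (aF n).
apply: approx_lim => // e e0.
have LB n := sqintB mS Lf (LF n).
have I4 : mu.-integrable (sq : set (RR R)) (fun x => ((2 * g x) ^+ 2)%:E).
  by case: (sqintZ mS 2 Lg).
have [] := @dominated_convergence _ _ _ mu sq mS
  (fun n x => ((f x - F n x) ^+ 2)%:E) (cst 0%E) (fun x => ((2 * g x) ^+ 2)%:E).
- by move=> n; case: (LB n) => _ /measurable_int.
- exact: measurable_cst.
- move: Ff; apply: (@filterS _ _ (ae_filter_ringOfSetsType mu)) => x Ffx sx; apply: cvg_EFin; first exact: nearW.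
  have h : f x - F n x @[n --> \oo] --> 0.
    by rewrite -(subrr (f x)); apply: cvgB; [exact: cvg_cst|exact: Ffx].
  have h2 : (f x - F n x) ^+ 2 @[n --> \oo] --> 0.
    rewrite (_ : 0 = 0 * 0 :> R); last by rewrite mul0r.
    rewrite (_ : (fun n => _) = (fun n => (f x - F n x) * (f x - F n x))).
      exact: (cvgM h h).
    by apply/funext => n; rewrite expr2.
  exact: h2.
- exact: I4.
- apply: aeW => x n sx; rewrite gee0_abs ?lee_fin ?sqr_ge0//.
  have h1 := Fg n x sx; have h2 := fg x sx.
  rewrite -(real_normK (num_real (f x - F n x))) lerXn2r ?nnegrE//.
    by rewrite mulr_ge0// (le_trans _ h2).
  by rewrite (le_trans (ler_normB _ _))// mulr_natl mulr2n lerD.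
move=> _ _; rewrite integral0.
move=> /fine_cvgP[_]; move=> /cvgrPdist_lt/(_ _ e0)[N _ /(_ N)].
rewrite /= leqnn => /(_ isT) h; exists (F N); first exact: aF.
move: h; rewrite sub0r normrN; apply: le_lt_trans.
by rewrite (integral_sqr mS (LB N))/= ler_norm.
Qed.

End Density.

Section Indicators.
Variable R : realType.
Implicit Types (f g : R * R -> R) (k l : int) (a : R).

Lemma approx_ae f g M : trig_approx f -> measurable_fun (sq : set (RR R)) g ->
  (forall x, sq x -> `|f x| <= M) -> (forall x, sq x -> `|g x| <= M) ->
  {ae mu, forall x, sq x -> f x = g x} -> trig_approx g.
Proof.
move=> af mg fM gM fg.
apply: (@approx_dominated _ (fun=> f) g (fun=> M)) => //.
  exact: L2_cst.
move: fg; apply: (@filterS _ _ (ae_filter_ringOfSetsType mu)) => x h sx.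
by rewrite h//; exact: cvg_cst.
Qed.

(** Its fixed points in [-1, 1] are -1, 0 and 1, and 0 is repelling. *)
Definition smoothsgn (y : R) : R := y * (3 - y ^+ 2) / 2.

Lemma smoothsgnN y : smoothsgn (- y) = - smoothsgn y.
Proof. by rewrite /smoothsgn; ring. Qed.

Lemma iter_smoothsgnN n y : iter n smoothsgn (- y) = - iter n smoothsgn y.
Proof. by elim: n => //= n ->; rewrite smoothsgnN. Qed.

Lemma iter_smoothsgn_bound n y : 0 < y -> y <= 1 ->
  y <= iter n smoothsgn y <= 1 /\
  1 - iter n smoothsgn y <= (1 - y / 2) ^+ n.
Proof.
move=> y0 y1; elim: n => [|n [/andP[h1 h2] h3]] /=.
  by rewrite lexx y1 expr0; split=> //; lra.
set z := iter n smoothsgn y in h1 h2 h3 *.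
have E : 1 - smoothsgn z = (1 - z) * ((1 - z) * (2 + z) / 2).
  by rewrite /smoothsgn; field.
have F : smoothsgn z = z + z * (1 - z) * (1 + z) / 2 by rewrite /smoothsgn; field.
split.
  apply/andP; split.
    rewrite F (le_trans h1)// lerDl divr_ge0// mulr_ge0//; last by lra.
    by rewrite mulr_ge0//; lra.
  by rewrite -subr_ge0 E mulr_ge0 ?subr_ge0// divr_ge0// mulr_ge0 ?subr_ge0//; lra.
rewrite E exprS mulrC ler_pM//.
- by rewrite divr_ge0// mulr_ge0 ?subr_ge0//; lra.
- by rewrite subr_ge0.
by nra.
Qed.

(** The iterates of y (3 - y^2) / 2 are polynomials that converge boundedly to
    the sign function on [-1, 1]: the distance to 1 shrinks geometrically. *)
Lemma cvg_iter_smoothsgn y : `|y| <= 1 ->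
  iter n smoothsgn y @[n --> \oo] --> Num.sg y.
Proof.
wlog y0 : y / 0 <= y => [H|].
  have [y0 y1|y0 y1] := leP 0 y; first exact: H.
  rewrite -[y]opprK sgrN; under eq_fun do rewrite iter_smoothsgnN.
  by apply: cvgN; apply: H; rewrite ?normrN// oppr_ge0 ltW.
rewrite ger0_norm// => y1; move: y0; rewrite le_eqVlt => /predU1P[<-|y0].
  rewrite sgr0; under eq_fun => n.
    rewrite (_ : iter n smoothsgn 0 = 0); last first.
      by elim: n => //= n ->; rewrite /smoothsgn !mul0r.
    over.
  exact: cvg_cst.
rewrite gtr0_sg//; apply/subr_cvg0.
have c : (1 - y / 2) ^+ n @[n --> \oo] --> 0.
  by apply: cvg_expr; rewrite ger0_norm; lra.
rewrite -oppr0; under eq_fun do rewrite -opprB.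
apply: cvgN; apply: (squeeze_cvgr _ (cvg_cst 0) c); apply: nearW => n.
by have [/andP[h1 h2] h3] := iter_smoothsgn_bound n y0 y1; rewrite subr_ge0 h2.
Qed.

Lemma approx_sgr f : trig_approx f -> (forall x, sq x -> `|f x| <= 1) ->
  trig_approx (fun x => Num.sg (f x)).
Proof.
move=> af f1.
have step n : trig_approx (fun x => iter n smoothsgn (f x)) /\
    forall x, sq x -> `|iter n smoothsgn (f x)| <= 1.
  elim: n => [|n [an bn]] //=; split.
    have a2 := approxM an an bn.
    have a3 := approxZ 2^-1 (approxM an (approxB (@approx_cst R 3) a2) bn).
    move: a3; congr trig_approx; apply/funext => x; rewrite /smoothsgn expr2; ring.
  move=> x sx; have := bn x sx; rewrite /smoothsgn.
  move: (iter n _ _) => z; rewrite !ler_norml => /andP[z1 z2].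
  have h1 : 0 <= (1 - z) ^+ 2 * (2 + z) by rewrite mulr_ge0 ?sqr_ge0//; lra.
  have h2 : 0 <= (1 + z) ^+ 2 * (2 - z) by rewrite mulr_ge0 ?sqr_ge0//; lra.
  by apply/andP; split; lra.
apply: (@approx_dominated _ (fun n x => iter n smoothsgn (f x)) _ (fun=> 1)).
- by move=> n; case: (step n).
- apply: (@measurable_fun_cvg _ _ _ _ (fun n x => iter n smoothsgn (f x))).
    by move=> n; case: (step n) => -[[]].
  by move=> x sx; apply: cvg_iter_smoothsgn; exact: f1.
- exact: L2_cst.
- by move=> n x sx; case: (step n) => _; exact.
- by move=> x _; rewrite normr_sg; case: (_ != _).
- by apply: aeW => x sx; apply: cvg_iter_smoothsgn; exact: f1.
Qed.

(** For 0 < c < 2 pi the sign of b - c is that of sin (c / 2) sin ((b - c) / 2),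
    which is a trigonometric polynomial in c; composing it with the sign function
    gives the indicator of c < b as (sgn + sgn^2) / 2. *)
Lemma approx_halfspace (c : (RR R) -> R) (b : R) :
  (forall a, trigpoly (fun x => cos (c x + a))) -> measurable_fun setT c ->
  {ae mu, forall x, sq x -> 0 < c x < 2 * pi} ->
  trig_approx (\1_(c @^-1` `]-oo, b[%classic) : R * R -> R).
Proof.
move=> tc mc ac; set A := c @^-1` _.
have mA : measurable A.
  by rewrite /A -[X in measurable X]setTI; apply: mc => //; exact: measurable_itv.
have mI : measurable_fun (sq : set (RR R)) (\1_A : (RR R) -> R).
  by apply: measurable_funTS; exact: measurable_indic.
have I1 x : `|(\1_A x : R)| <= 1 by rewrite indicE ger0_norm// lern1; case: (_ \in _).
have AE x : (x \in A) = (c x < b).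
  by apply/idP/idP => [/set_mem|h]; rewrite ?inE /A/= in_itv.
have [b0|b0] := leP b 0.
  apply: (@approx_ae (fun=> 0) _ 1 (approx_cst 0)) => //.
    by move=> x _; rewrite normr0.
  move: ac; apply: (@filterS _ _ (ae_filter_ringOfSetsType mu)) => x h sx.
  have /andP[h1 h2] := h sx.
  by rewrite indicE AE ltNge (le_trans b0 (ltW h1)).
have [b2|b2] := leP (2 * pi) b.
  apply: (@approx_ae (fun=> 1) _ 1 (approx_cst 1)) => //.
    by move=> x _; rewrite normr1.
  move: ac; apply: (@filterS _ _ (ae_filter_ringOfSetsType mu)) => x h sx.
  have /andP[h1 h2] := h sx.
  by rewrite indicE AE (lt_le_trans h2 b2).
pose y (x : R * R) := 2^-1 * (cos (c x + - (b / 2)) - cos (b / 2)).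
have ay : trig_approx y.
  by apply/approxZ/approxB; [apply: approx_trigpoly|exact: approx_cst].
have y1 x : sq x -> `|y x| <= 1.
  move=> _; rewrite normrM ger0_norm ?invr_ge0// ler_pdivrMl// mulr1.
  by rewrite (le_trans (ler_normB _ _))// -[leRHS]/(1 + 1) lerD// cos_max.
have sy := approx_sgr ay y1.
have s1 x : `|Num.sg (y x)| <= 1 by rewrite normr_sg lern1; case: (_ != _).
have sy2 := approxM sy sy (fun x _ => s1 x).
apply: (@approx_ae _ _ 1 (approxZ 2^-1 (approxD sy sy2))) => //.
  move=> x _; rewrite normrM ger0_norm ?invr_ge0// ler_pdivrMl// mulr1.
  rewrite (le_trans (ler_normD _ _))// -[leRHS]/(1 + 1) lerD// normrM.
  by rewrite -[leRHS]mulr1 ler_pM.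
move: ac; apply: (@filterS _ _ (ae_filter_ringOfSetsType mu)) => x h sx.
have /andP[c0 c2] := h sx.
have -> : y x = sin (c x / 2) * sin ((b - c x) / 2).
  rewrite /y (_ : c x + - (b / 2) = c x / 2 - (b - c x) / 2); last by field.
  rewrite (_ : b / 2 = c x / 2 + (b - c x) / 2); last by field.
  by rewrite cosB cosD; field.
have sc : 0 < sin (c x / 2).
  by apply: sin_gt0_pi; rewrite divr_gt0//= ltr_pdivrMr// mulrC.
rewrite sgrM (gtr0_sg sc) mul1r indicE AE.
have [cb|cb|->] := ltgtP (c x) b.
- have sb : 0 < sin ((b - c x) / 2).
    by apply: sin_gt0_pi; rewrite divr_gt0 ?subr_gt0//= ltr_pdivrMr//; lra.
  by rewrite gtr0_sg// mul1r/=; field.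
- have sb : 0 < sin ((c x - b) / 2).
    by apply: sin_gt0_pi; rewrite divr_gt0 ?subr_gt0//= ltr_pdivrMr//; lra.
  rewrite -opprB mulNr sinN sgrN gtr0_sg//=; ring.
- by rewrite subrr mul0r sin0 sgr0 mul0r addr0 mulr0.
Qed.

Definition approx_sets : set (set (RR R)) :=
  [set A | measurable A /\ trig_approx (\1_A : R * R -> R)].

Lemma indic_le1 (A : set (RR R)) x : `|(\1_A x : R)| <= 1.
Proof. by rewrite indicE ger0_norm// lern1; case: (_ \in _). Qed.

(** The algebra structure of the bounded approximable functions yields finite
    unions, and dominated convergence the countable ones. *)
Lemma sigma_algebra_approx_sets : sigma_algebra setT approx_sets.
Proof.
have aC A : approx_sets A -> approx_sets (~` A).
  move=> [mA aA]; split; first exact: measurableC.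
  have := approxB (@approx_cst R 1) aA; congr trig_approx.
  by apply/funext => x; rewrite !indicE in_setC; case: (_ \in A); rewrite /= ?subr0 ?subrr.
have a0 : approx_sets set0.
  split; first exact: measurable0.
  have := @approx_cst R 0; congr trig_approx.
  by apply/funext => x; rewrite indicE in_set0.
have aU A B : approx_sets A -> approx_sets B -> approx_sets (A `|` B).
  move=> [mA aA] [mB aB]; split; first exact: measurableU.
  have := approxB (approxD aA aB) (approxM aA aB (fun x _ => indic_le1 A x)).
  congr trig_approx; apply/funext => x; rewrite !indicE in_setU.
  by case: (_ \in A); case: (_ \in B); rewrite /= ?mulr0 ?mul0r ?mulr1 ?subr0 ?addr0 ?add0r ?addrK.
split => //; first by move=> A aA; rewrite setTD; exact: aC.
move=> A aA.
have mU : measurable (\bigcup_k A k).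
  by apply: bigcupT_measurable => k; case: (aA k).
have aP n : approx_sets (\big[setU/set0]_(i < n) A i).
  elim: n => [|n IH]; first by rewrite big_ord0.
  by rewrite big_ord_recr; exact: aU.
split=> //.
apply: (@approx_dominated _ (fun n => \1_(\big[setU/set0]_(i < n) A i) : R * R -> R)
  _ (fun=> 1)).
- by move=> n; case: (aP n).
- by apply: measurable_funTS; exact: measurable_indic.
- exact: L2_cst.
- by move=> n x _; exact: indic_le1.
- by move=> x _; exact: indic_le1.
apply: aeW => x _; apply: cvg_near_cst.
have [[k _ Akx]|nx] := pselect ((\bigcup_k A k) x).
  exists k.+1 => // n /= kn; rewrite !indicE.
  have -> : x \in \bigcup_k A k by apply/mem_set; exists k.
  have -> // : x \in \big[setU/set0]_(i < n) A i.
  by apply/mem_set; rewrite -bigcup_mkord; exists k.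
apply: nearW => n; rewrite !indicE.
have -> : (x \in \bigcup_k A k) = false by apply/memNset.
have -> // : (x \in \big[setU/set0]_(i < n) A i) = false.
apply/memNset; rewrite -bigcup_mkord => -[k _ Akx].
by apply: nx; exists k.
Qed.

Lemma approx_sets_preimage (c : (RR R) -> R) :
  (forall a, trigpoly (fun x => cos (c x + a))) ->
  (measurable_fun setT (c : (RR R) -> measurableTypeR R)) ->
  {ae mu, forall x, sq x -> 0 < c x < 2 * pi} ->
  forall B : set (measurableTypeR R), measurable B -> approx_sets (c @^-1` B).
Proof.
move=> tc mc ac B mB.
have : <<s (@RGenInftyO.G R) >> B.
  have := RGenInftyO.measurableE R => E.
  by move: mB; rewrite [X in X B]E.
apply: (@smallest_sub _ _ _ [set A | approx_sets (c @^-1` A)]).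
  have [s0 sC sU] := sigma_algebra_approx_sets.
  split.
  - by rewrite /= preimage_set0.
  - by move=> A /= aA; rewrite setTD preimage_setC -setTD; exact: sC.
  - by move=> F /= aF; rewrite preimage_bigcup; exact: sU.
move=> _ [x ->] /=; split.
  by rewrite -[X in measurable X]setTI; apply: mc => //; exact: measurable_itv.
exact: approx_halfspace.
Qed.

Lemma ae_coord_neq (b : R) :
  {ae mu, forall x : (RR R), x.1 != b} /\ {ae mu, forall x : (RR R), x.2 != b}.
Proof.
have m1 : @measurable _ (measurableTypeR R) [set b] by exact: measurable_set1.
split.
  exists ([set b] `*` setT); split; first exact: measurableX.
    by rewrite mu2_rect//= lebesgue_measure_set1 mul0e.
  by move=> [x y] /=; move/negP; rewrite negbK => /eqP.
exists (setT `*` [set b]); split; first exact: measurableX.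
  by rewrite mu2_rect//= lebesgue_measure_set1 mule0.
by move=> [x y] /=; move/negP; rewrite negbK => /eqP.
Qed.

Lemma approx_indic (A : set (RR R)) : measurable A -> trig_approx (\1_A : R * R -> R).
Proof.
move=> mA; suff : approx_sets A by case.
have [a1 a2] := ae_coord_neq 0; have [b1 b2] := ae_coord_neq (2 * pi).
have F := ae_filter_ringOfSetsType (@mu2 R).
have S1 B : measurable B -> approx_sets (@fst R R @^-1` B).
  apply: approx_sets_preimage; last first.
  - have := @filterI _ _ F _ _ a1 b1; apply: filterS => x [h1 h2] [/=].
    rewrite !in_itv/= => /andP[h3 h4] _.
    by rewrite !lt_neqAle eq_sym h1 h2 h3.
  - exact: measurable_fst.
  - move=> a; have := trigpoly_mode 1 0 a; congr trigpoly; apply/funext => x.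
    by rewrite /mode mulr1z mul1r mul0r addr0.
have S2 B : measurable B -> approx_sets (@snd R R @^-1` B).
  apply: approx_sets_preimage; last first.
  - have := @filterI _ _ F _ _ a2 b2; apply: filterS => x [h1 h2] [/= _].
    rewrite !in_itv/= => /andP[h3 h4].
    by rewrite !lt_neqAle eq_sym h1 h2 h3.
  - exact: measurable_snd.
  - move=> a; have := trigpoly_mode 0 1 a; congr trigpoly; apply/funext => x.
    by rewrite /mode mulr1z mul1r mul0r add0r.
move: A mA; apply: smallest_sub; first exact: sigma_algebra_approx_sets.
by move=> A [[B mB <-]|[B mB <-]]; rewrite setTI; [exact: S1|exact: S2].
Qed.

Import HBNNSimple.

Lemma approx_ge0 f : L2 f -> (forall x, sq x -> 0 <= f x) -> trig_approx f.
Proof.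
move=> Lf f0; have mf : measurable_fun (sq : set (RR R)) f by case: Lf.
have mEf : measurable_fun (sq : set (RR R)) (EFin \o f) by exact/measurable_EFinP.
pose F n : (RR R) -> R := nnsfun_approx mS mEf n.
have fE0 x : sq x -> (0 <= (EFin \o f) x)%E by move=> sx; rewrite lee_fin f0.
apply: (@approx_dominated _ F f f) => //.
- move=> n; have := fimfunEord (nnsfun_approx mS mEf n) => E.
  rewrite (_ : F n = (fun x => F n x))//; under eq_fun do rewrite /F E.
  apply: approx_sum => i; apply: approxZ; apply: approx_indic.
  exact: measurable_sfunP.
- move=> n x sx; rewrite ger0_norm// /F nnsfun_approxE -lee_fin.
  exact: le_approx.
- by move=> x sx; rewrite ger0_norm// f0.
- apply: aeW => x sx; have := cvg_nnsfun_approx mS mEf fE0 sx.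
  by move/fine_cvgP => [_]; exact.
Qed.

(** Trigonometric polynomials are dense in L_2 of the torus: the sets with
    approximable indicator form a sigma-algebra (bounded approximable functions
    are an algebra closed under bounded limits) that contains the generating
    half-spaces. *)
Lemma trigpoly_dense f : L2 f -> trig_approx f.
Proof.
move=> Lf; have mf : measurable_fun (sq : set (RR R)) f by case: Lf.
have mfp : measurable_fun (sq : set (RR R)) (fun x => Num.max (f x) 0).
  by apply: measurable_maxr.
have mfn : measurable_fun (sq : set (RR R)) (fun x => Num.max (- f x) 0).
  by apply: measurable_maxr => //; exact: measurableT_comp.
have -> : f = (fun x => Num.max (f x) 0 - Num.max (- f x) 0).
  by apply/funext => x; have [h|h] := leP (f x) 0; have [k|k] := leP (- f x) 0; lra.
have normr_max0 (y : R) : `|Num.max y 0| <= `|y|.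
  by have [h|h] := leP y 0; rewrite ?normr0.
apply: approxB; apply: approx_ge0.
- exact: (sqint_dominated mS Lf mfp).
- by move=> x _; rewrite le_max lexx orbT.
- by apply: (sqint_dominated mS Lf mfn) => x _; rewrite -[leRHS]normrN.
- by move=> x _; rewrite le_max lexx orbT.
Qed.

End Indicators.

(** * Fourier coefficients and Parseval's identity *)

(** Double Fourier series are summed over squares of frequencies. *)
Definition int_range (N : nat) : seq int :=
  [seq i%:Z - N%:Z | i <- iota 0 (N.*2.+1)].

Definition box (N : nat) : seq (int * int) :=
  [seq (i, j) | i <- int_range N, j <- int_range N].

Lemma mem_int_range N (k : int) : (k \in int_range N) = (`|k| <= N%:Z).
Proof.
apply/mapP/idP => [H|kN].
  by case: H => i; rewrite mem_iota /= => Hi ->; lia.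
exists (absz (k + N%:Z)); last by lia.
by rewrite mem_iota /=; lia.
Qed.

Lemma uniq_int_range N : uniq (int_range N).
Proof. by rewrite map_inj_uniq ?iota_uniq// => i j; lia. Qed.

Lemma mem_box N (p : int * int) :
  (p \in box N) = (`|p.1| <= N%:Z) && (`|p.2| <= N%:Z).
Proof.
rewrite -!mem_int_range; apply/allpairsP/andP => [H|].
  by case: H => -[i j] [/= h1 h2 ->].
by case: p => i j [h1 h2]; exists (i, j).
Qed.

Lemma uniq_box N : uniq (box N).
Proof.
by apply: allpairs_uniq; rewrite ?uniq_int_range// => -[a b] [c d] _ _ /= ->.
Qed.

Section Fourier.
Variable R : realType.
Implicit Types (f g u v : R * R -> R) (k l : int) (a : R) (p : int * int).

(** The real and imaginary parts of the Fourier coefficient ([fourierE]), in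
    terms of real integrals; recall cos (y + pi / 2) = - sin y. *)
Definition fRe v p : R := (4 * pi ^+ 2)^-1 * dot v (mode p.1 p.2 0).

Definition fIm v p : R := (4 * pi ^+ 2)^-1 * dot v (mode p.1 p.2 (pi / 2)).

Lemma fourierE v p : fourier v p.1 p.2 = (fRe v p +i* fIm v p)%C.
Proof.
case: p => k l; apply/eqP; rewrite eq_complex /fourier /cintT2 /=.
rewrite !mul0r ?subr0 ?addr0; apply/andP; split; apply/eqP; congr (_ * _);
  rewrite /intT2 /ip; apply: eq_Rintegral => x _ /=; rewrite /mode.
- rewrite !mul0r !subr0 addr0 !cosN !sinN addr0 cosD; ring.
- rewrite !mul0r !subr0 addr0 !cosN !sinN cosDpihalf sinD; ring.
Qed.

(** Re (conj u_p * v_p): all sums can be taken in R since the functions are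
    real-valued. *)
Definition fpair u v p : R := fRe u p * fRe v p + fIm u p * fIm v p.

Definition fsqr v p : R := fRe v p ^+ 2 + fIm v p ^+ 2.

Lemma fsqr_ge0 v p : 0 <= fsqr v p.
Proof. by rewrite addr_ge0// sqr_ge0. Qed.

Lemma fpair_diag v p : fpair v v p = fsqr v p.
Proof. by rewrite /fpair /fsqr !expr2. Qed.

Lemma pi_neq0 : pi != 0 :> R.
Proof. by rewrite gt_eqF// pi_gt0. Qed.

Lemma pi4_neq0 : 4 * pi ^+ 2 != 0 :> R.
Proof. by rewrite mulf_neq0// expf_neq0// gt_eqF// pi_gt0. Qed.

(** The partial sum of the Fourier series in real form, where p and - p
    contribute the same term. *)
Definition partial_fourier N v (x : R * R) : R :=
  \sum_(p <- box N) (fRe v p * mode p.1 p.2 0 x + fIm v p * mode p.1 p.2 (pi / 2) x).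

Lemma L2_fourier_term v p :
  L2 (fun x => fRe v p * mode p.1 p.2 0 x + fIm v p * mode p.1 p.2 (pi / 2) x).
Proof. by apply: sqintD => //; apply: sqintZ => //; exact: L2_mode. Qed.

Lemma L2_partial_fourier N v : L2 (partial_fourier N v).
Proof. by apply: sqint_sum => // p; exact: L2_fourier_term. Qed.

Lemma dot_partial_fourier N v u : L2 u ->
  dot (partial_fourier N v) u = 4 * pi ^+ 2 * \sum_(p <- box N) fpair v u p.
Proof.
move=> Lu; rewrite [LHS]ip_suml//; last by move=> p; exact: L2_fourier_term.
rewrite mulr_sumr; apply: eq_bigr => p _.
rewrite ipDl//; try by apply: sqintZ => //; exact: L2_mode.
rewrite !ipZl//; try exact: L2_mode.
rewrite (ipC mu sq _ u) (ipC mu sq (mode _ _ (pi / 2))) /fpair [fRe u p]/fRe [fIm u p]/fIm.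
by have := pi_neq0; move: pi => c c0; field.
Qed.

Lemma modeE k l a x :
  mode k l a x = cos a * mode k l 0 x + sin a * mode k l (pi / 2) x.
Proof.
rewrite /mode addr0 cosDpihalf cosD; ring.
Qed.

Lemma dot_modeE v k l a : L2 v -> dot v (mode k l a) =
  4 * pi ^+ 2 * (cos a * fRe v (k, l) + sin a * fIm v (k, l)).
Proof.
move=> Lv; rewrite (_ : mode k l a =
   (fun x => cos a * mode k l 0 x + sin a * mode k l (pi / 2) x)); last first.
  by apply/funext => x; exact: modeE.
rewrite ipDr//; try by apply: sqintZ => //; exact: L2_mode.
rewrite !ipZr//; try exact: L2_mode.
by rewrite /fRe /fIm; have := pi_neq0; move: pi => c c0; field.
Qed.

Lemma fRe_opp v p : fRe v (- p.1, - p.2) = fRe v p.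
Proof.
rewrite /fRe; congr (_ * dot _ _); apply/funext => x; rewrite /mode/= -cosN.
by congr cos; rewrite !mulrNz; ring.
Qed.

Lemma fIm_opp v p : L2 v -> fIm v (- p.1, - p.2) = - fIm v p.
Proof.
move=> Lv; rewrite /fIm -mulrN; congr (_ * _).
rewrite -mulN1r -ipZr//; last exact: L2_mode.
congr ip; apply/funext => x; rewrite /mode/= !cosDpihalf -[X in - sin X]opprK sinN.
by rewrite mulN1r !opprK; congr sin; rewrite !mulrNz; ring.
Qed.

Lemma fRe_mode k l a p : fRe (mode k l a) p =
  2^-1 * (if p == (k, l) then cos a else 0)
  + 2^-1 * (if p == (- k, - l) then cos a else 0).
Proof.
case: p => k' l'; rewrite /fRe dot_mode /= subr0 addr0 !xpair_eqE.
rewrite (eq_sym k') (eq_sym l') (eq_sym k' (- k)) (eq_sym l' (- l)) !eqr_oppLR.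
by case: ifP => _; case: ifP => _; have := pi_neq0; move: pi => c c0; field.
Qed.

Lemma fIm_mode k l a p : fIm (mode k l a) p =
  2^-1 * (if p == (k, l) then sin a else 0)
  - 2^-1 * (if p == (- k, - l) then sin a else 0).
Proof.
case: p => k' l'; rewrite /fIm dot_mode /= cosBpihalf cosDpihalf !xpair_eqE.
rewrite (eq_sym k') (eq_sym l') (eq_sym k' (- k)) (eq_sym l' (- l)) !eqr_oppLR.
by case: ifP => _; case: ifP => _; have := pi_neq0; move: pi => c c0; field.
Qed.

Lemma sum_box_at N q (F : int * int -> R) : q \in box N ->
  \sum_(p <- box N) (if p == q then F p else 0) = F q.
Proof.
move=> qN; rewrite (bigD1_seq q) ?uniq_box//= eqxx big1 ?addr0// => p pq.
by rewrite (negbTE pq).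
Qed.

(** The projection onto the modes of the box reproduces the inner products with
    these modes, so that what it leaves out is orthogonal to them. *)
Lemma dot_partial_fourier_mode N v k l a : L2 v -> (k, l) \in box N ->
  dot (partial_fourier N v) (mode k l a) = dot v (mode k l a).
Proof.
move=> Lv klN; have klN' : (- k, - l) \in box N.
  by move: klN; rewrite !mem_box/= !normrN.
rewrite dot_partial_fourier; last exact: L2_mode.
rewrite dot_modeE//; congr (_ * _).
rewrite (eq_bigr (fun p =>
    (if p == (k, l) then 2^-1 * (fRe v p * cos a + fIm v p * sin a) else 0)
  + (if p == (- k, - l) then 2^-1 * (fRe v p * cos a - fIm v p * sin a) else 0))).
  rewrite big_split/= !sum_box_at// (fRe_opp v (k, l)) (fIm_opp (k, l))//.
  by field.
move=> p _; rewrite /fpair fRe_mode fIm_mode.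
by case: (p == (k, l)); case: (p == (- k, - l)); field.
Qed.

Lemma dot_partial_fourier_trigpoly f : trigpoly f ->
  \forall N \near \oo, forall v, L2 v -> dot (partial_fourier N v) f = dot v f.
Proof.
elim=> [k l a|f1 f2 t1 h1 t2 h2|c f1 t1 h1].
- exists (absz k + absz l)%N => // N /= klN v Lv.
  by apply: dot_partial_fourier_mode => //; rewrite mem_box/=; lia.
- near=> N => v Lv; have LP := L2_partial_fourier N v.
  rewrite !ipDr//; try exact: L2_trigpoly.
  by congr (_ + _); move: v Lv {LP}; near: N.
- near=> N => v Lv; have LP := L2_partial_fourier N v.
  rewrite !ipZr//; try exact: L2_trigpoly.
  by congr (_ * _); move: v Lv {LP}; near: N.
Unshelve. all: by end_near. Qed.

Lemma dot_partial_fourier_self N v : L2 v ->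
  dot (partial_fourier N v) (partial_fourier N v) = dot v (partial_fourier N v).
Proof.
move=> Lv; have LP := L2_partial_fourier N v.
rewrite [RHS]ipC [LHS]ip_suml ?[RHS]ip_suml//;
  try by move=> p; exact: L2_fourier_term.
rewrite !big_seq; apply: eq_bigr => -[k l] kl.
rewrite !ipDl//; try by apply: sqintZ => //; exact: L2_mode.
rewrite !ipZl//; try exact: L2_mode.
by rewrite !(ipC mu sq (mode _ _ _)) !dot_partial_fourier_mode.
Qed.

(** The partial sums are best approximations among the trigonometric polynomials
    of their degree, so that density forces them to converge. *)
Lemma cvg_partial_fourier v : L2 v ->
  dot (fun x => v x - partial_fourier N v x) (fun x => v x - partial_fourier N v x)
    @[N --> \oo] --> 0.
Proof.
move=> Lv; apply/cvgrPdist_lt => e e0.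
have [f tf vf] := (trigpoly_dense Lv).2 e e0.
have Lf := L2_trigpoly tf.
have fN := dot_partial_fourier_trigpoly tf.
near=> N.
have LP := L2_partial_fourier N v.
rewrite sub0r normrN ger0_norm ?ip_ge0//; apply: le_lt_trans vf.
have H : dot (partial_fourier N v) f = dot v f.
  by move: v Lv {LP}; near: N.
have self := dot_partial_fourier_self N Lv.
have := ip_ge0 mu sq (fun x => f x - partial_fourier N v x).
rewrite !ip_sqrB// self (ipC mu sq f) H; lra.
Unshelve. all: by end_near. Qed.

Theorem Parseval u v : L2 u -> L2 v ->
  \sum_(p <- box N) fpair u v p @[N --> \oo] --> (4 * pi ^+ 2)^-1 * dot u v.
Proof.
move=> Lu Lv.
rewrite (_ : (fun N => _) =
  fun N => (4 * pi ^+ 2)^-1 * dot (partial_fourier N u) v); last first.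
  by apply/funext => N; rewrite dot_partial_fourier// mulKf// pi4_neq0.
apply: cvgM; first exact: cvg_cst.
apply: (cvg_ip mS) => //.
- by apply: nearW => N; exact: L2_partial_fourier.
- exact: nearW.
- rewrite [X in X @ _ --> _](_ : _ = (fun N =>
    dot (fun x => u x - partial_fourier N u x) (fun x => u x - partial_fourier N u x))).
    exact: cvg_partial_fourier.
  by apply/funext => N; rewrite /ip; apply: eq_Rintegral => x _; ring.
- rewrite (_ : (fun s => _) = (fun=> 0)); first exact: cvg_cst.
  apply/funext => _; rewrite /ip /Rintegral integral0_eq// => x _.
  by rewrite subrr mulr0.
Qed.

End Fourier.

(** * Weak derivatives and Sobolev norms in terms of Fourier coefficients *)

Section WeakDerivatives.
Variable R : realType.
Implicit Types (f g u v w : R * R -> R) (k l : int) (a : R) (p : int * int).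

Lemma L2T2_L2 v : L2T2 v -> L2 v.
Proof.
by case=> _ mv lv; apply: sqintP => //; exact: measurable_funTS.
Qed.

Lemma L2sqnorm_dot v : L2 v -> L2sqnorm v = (dot v v)%:E.
Proof. exact: integral_sqr. Qed.

Lemma dot_ae u v w : L2 u -> L2 v -> L2 w ->
  {ae mu, forall x, sq x -> u x = v x} -> dot u w = dot v w.
Proof.
move=> Lu Lv Lw uv; rewrite /ip /Rintegral; congr fine.
have mprod f : L2 f -> measurable_fun (sq : set (RR R)) (EFin \o (fun x => f x * w x)).
  by move=> [mf _]; apply/measurable_EFinP/measurable_funM => //; case: Lw.
apply: ae_eq_integral => //; try exact: mprod.
by move: uv; apply: (@filterS _ _ (ae_filter_ringOfSetsType mu)) => x h sx; rewrite h.
Qed.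

Lemma fReD u v p : L2 u -> L2 v -> fRe (fun x => u x + v x) p = fRe u p + fRe v p.
Proof. by move=> Lu Lv; rewrite /fRe ipDl ?mulrDr//; exact: L2_mode. Qed.

Lemma fImD u v p : L2 u -> L2 v -> fIm (fun x => u x + v x) p = fIm u p + fIm v p.
Proof. by move=> Lu Lv; rewrite /fIm ipDl ?mulrDr//; exact: L2_mode. Qed.

Lemma fReZ c v p : L2 v -> fRe (fun x => c * v x) p = c * fRe v p.
Proof. by move=> Lv; rewrite /fRe ipZl 1?mulrCA//; exact: L2_mode. Qed.

Lemma fImZ c v p : L2 v -> fIm (fun x => c * v x) p = c * fIm v p.
Proof. by move=> Lv; rewrite /fIm ipZl 1?mulrCA//; exact: L2_mode. Qed.

Lemma fReB u v p : L2 u -> L2 v -> fRe (fun x => u x - v x) p = fRe u p - fRe v p.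
Proof. by move=> Lu Lv; rewrite /fRe ipBl ?mulrBr//; exact: L2_mode. Qed.

Lemma fImB u v p : L2 u -> L2 v -> fIm (fun x => u x - v x) p = fIm u p - fIm v p.
Proof. by move=> Lu Lv; rewrite /fIm ipBl ?mulrBr//; exact: L2_mode. Qed.

Lemma meanE v : mean v = fRe v (0, 0).
Proof. by rewrite /mean (fourierE v (0, 0)). Qed.

Lemma fIm00 v : L2 v -> fIm v (0, 0) = 0.
Proof.
move=> Lv; have /= := fIm_opp (0, 0) Lv; rewrite oppr0 => h.
by move: h; move: (fIm _ _) => y h; lra.
Qed.

Lemma normc_fourier v p : Normc.normc (fourier v p.1 p.2) ^+ 2 = fsqr v p.
Proof. by rewrite fourierE/= sqr_sqrtr// addr_ge0// sqr_ge0. Qed.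

(** The eigenvalues of - Delta. *)
Definition lam p : R := p.1%:~R ^+ 2 + p.2%:~R ^+ 2.

Lemma lam_ge0 p : 0 <= lam p.
Proof. by rewrite addr_ge0// sqr_ge0. Qed.

Lemma lam00 : lam (0, 0) = 0.
Proof. by rewrite /lam/= mulr0z expr0n addr0. Qed.

(** The eigenvalues are integers: there is a gap between 1 and 2. *)
Lemma lam_cases p : [\/ p = (0, 0), lam p = 1 | 2 <= lam p].
Proof.
have E : lam p = (p.1 ^+ 2 + p.2 ^+ 2)%:~R by rewrite /lam intrD !rmorphXn.
rewrite E; case: p {E} => k l /=.
have ge2 (z : int) : 2 <= z -> (2 : R) <= z%:~R.
  by move=> z2; rewrite (_ : 2 = 2%:~R) ?ler_int.
have ge1 (z : int) : z != 0 -> 1 <= z ^+ 2 by nia.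
have [->|k0] := eqVneq k 0; have [->|l0] := eqVneq l 0.
- by constructor 1.
- have := ge1 l l0; rewrite expr0n add0r le_eqVlt => /predU1P[<-|h].
    by constructor 2.
  by constructor 3; apply: ge2; lia.
- have := ge1 k k0; rewrite expr0n addr0 le_eqVlt => /predU1P[<-|h].
    by constructor 2.
  by constructor 3; apply: ge2; lia.
- by constructor 3; apply: ge2; have := ge1 k k0; have := ge1 l l0; lia.
Qed.

Lemma intr_complex (z : int) : (z%:~R : R[i])%C = (z%:~R +i* 0)%C.
Proof. by rewrite -[LHS](rmorph_int (real_complex R)). Qed.

Lemma fRe_dtheta v w p : is_dtheta v w -> fRe w p = - (p.1%:~R * fIm v p).
Proof.
case=> _ _ /(_ p.1 p.2); rewrite !fourierE intr_complex => /eqP.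
by rewrite eq_complex /= => /andP[/eqP-> _]; ring.
Qed.

Lemma fIm_dtheta v w p : is_dtheta v w -> fIm w p = p.1%:~R * fRe v p.
Proof.
case=> _ _ /(_ p.1 p.2); rewrite !fourierE intr_complex => /eqP.
by rewrite eq_complex /= => /andP[_ /eqP->]; ring.
Qed.

Lemma fRe_dzeta v w p : is_dzeta v w -> fRe w p = - (p.2%:~R * fIm v p).
Proof.
case=> _ _ /(_ p.1 p.2); rewrite !fourierE intr_complex => /eqP.
by rewrite eq_complex /= => /andP[/eqP-> _]; ring.
Qed.

Lemma fIm_dzeta v w p : is_dzeta v w -> fIm w p = p.2%:~R * fRe v p.
Proof.
case=> _ _ /(_ p.1 p.2); rewrite !fourierE intr_complex => /eqP.
by rewrite eq_complex /= => /andP[_ /eqP->]; ring.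
Qed.

(** Identities between integrals are checked on each Fourier mode. *)
Lemma Parseval_eq u v u' v' c : L2 u -> L2 v -> L2 u' -> L2 v' ->
  (forall p, fpair u v p = c * fpair u' v' p) -> dot u v = c * dot u' v'.
Proof.
move=> Lu Lv Lu' Lv' E; have P1 := Parseval Lu Lv.
have P2 : \sum_(p <- box N) fpair u v p @[N --> \oo] -->
    c * ((4 * pi ^+ 2)^-1 * dot u' v').
  rewrite (_ : (fun N => _) = fun N => c * \sum_(p <- box N) fpair u' v' p).
    by apply: cvgM; [exact: cvg_cst|exact: Parseval].
  by apply/funext => N; rewrite mulr_sumr; apply: eq_bigr => p _.
apply: (mulfI (invr_neq0 (@pi4_neq0 R))).
by rewrite [RHS]mulrCA; exact: (cvg_unique (@Rhausdorff R) P1 P2).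
Qed.

(** The multiplier i k of a derivative is skew-adjoint, which Parseval's identity
    turns into integration by parts. *)
Lemma dot_dtheta u u1 v v1 : is_dtheta u u1 -> is_dtheta v v1 ->
  dot u v1 = - dot u1 v.
Proof.
move=> du dv; have [/L2T2_L2 Lu /L2T2_L2 Lu1 _] := du.
have [/L2T2_L2 Lv /L2T2_L2 Lv1 _] := dv.
rewrite -mulN1r; apply: Parseval_eq => // p.
by rewrite /fpair !(fRe_dtheta _ du, fRe_dtheta _ dv, fIm_dtheta _ du, fIm_dtheta _ dv); ring.
Qed.

Lemma dot_dzeta u u1 v v1 : is_dzeta u u1 -> is_dzeta v v1 ->
  dot u v1 = - dot u1 v.
Proof.
move=> du dv; have [/L2T2_L2 Lu /L2T2_L2 Lu1 _] := du.
have [/L2T2_L2 Lv /L2T2_L2 Lv1 _] := dv.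
rewrite -mulN1r; apply: Parseval_eq => // p.
by rewrite /fpair !(fRe_dzeta _ du, fRe_dzeta _ dv, fIm_dzeta _ du, fIm_dzeta _ dv); ring.
Qed.

Lemma L2_grad v g1 g2 : is_grad v g1 g2 -> [/\ L2 v, L2 g1 & L2 g2].
Proof.
by move=> [[/L2T2_L2 Lv /L2T2_L2 Lg1 _] [_ /L2T2_L2 Lg2 _]].
Qed.

Lemma fsqr_grad v g1 g2 p : is_grad v g1 g2 ->
  fsqr g1 p + fsqr g2 p = lam p * fsqr v p.
Proof.
move=> [d1 d2]; rewrite /fsqr (fRe_dtheta _ d1) (fIm_dtheta _ d1).
by rewrite (fRe_dzeta _ d2) (fIm_dzeta _ d2) /lam; ring.
Qed.

Lemma laplacian_L2 v w : is_laplacian v w -> L2 w.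
Proof.
move=> [g1 [g2 [_ [a [b [[_ /L2T2_L2 La _] [_ /L2T2_L2 Lb _] ->]]]]]].
exact: sqintD.
Qed.

Lemma laplacian_coefs v w p : is_laplacian v w ->
  fRe w p = - lam p * fRe v p /\ fIm w p = - lam p * fIm v p.
Proof.
move=> [g1 [g2 [[d1 d2] [a [b [e1 e2 ->]]]]]].
have [_ /L2T2_L2 La _] := e1; have [_ /L2T2_L2 Lb _] := e2.
rewrite fReD// fImD// (fRe_dtheta _ e1) (fIm_dtheta _ e1) (fRe_dzeta _ e2).
rewrite (fIm_dzeta _ e2) (fRe_dtheta _ d1) (fIm_dtheta _ d1) (fRe_dzeta _ d2).
by rewrite (fIm_dzeta _ d2) /lam; split; ring.
Qed.

(** q = Delta v + v, up to null sets. *)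
Definition pressure v q := [/\ L2 v, L2 q &
  forall p, fRe q p = (1 - lam p) * fRe v p /\ fIm q p = (1 - lam p) * fIm v p].

Lemma pressure_laplacian v w : L2 v -> is_laplacian v w ->
  pressure v (fun x => w x + v x).
Proof.
move=> Lv lw; have Lw := laplacian_L2 lw; split=> //; first exact: sqintD.
move=> p; have [h1 h2] := laplacian_coefs p lw.
by rewrite fReD// fImD// h1 h2; split; ring.
Qed.

Lemma pressureB u v q r : pressure u q -> pressure v r ->
  pressure (fun x => u x - v x) (fun x => q x - r x).
Proof.
move=> [Lu Lq hq] [Lv Lr hr]; split; try exact: sqintB.
move=> p; have [h1 h2] := hq p; have [h3 h4] := hr p.
by rewrite !fReB// !fImB// h1 h2 h3 h4; split; ring.
Qed.

(** The symmetry of Delta + 1. *)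
Lemma dot_pressure u v q r : pressure u q -> pressure v r -> dot q v = dot u r.
Proof.
move=> [Lu Lq hq] [Lv Lr hr]; rewrite -[RHS]mul1r; apply: Parseval_eq => // p.
have [h1 h2] := hq p; have [h3 h4] := hr p.
by rewrite /fpair h1 h2 h3 h4; ring.
Qed.

(** ** Sobolev norms *)

Lemma HsqnormE (s : R) v :
  Hsqnorm s v = (\esum_(p in [set: int * int]) ((1 + lam p) `^ s * fsqr v p)%:E)%E.
Proof.
by apply: eq_esum => p _; rewrite normc_fourier addrA.
Qed.

Lemma sum_box_le_esum (F : int * int -> R) N : (forall p, 0 <= F p) ->
  ((\sum_(p <- box N) F p)%:E <= \esum_(p in [set: int * int]) (F p)%:E)%E.
Proof.
move=> F0; apply: esum_ge; exists [set` box N]; first by split=> //; exact: finite_seq.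
by rewrite -fsbig_seq ?uniq_box// sumEFin.
Qed.

(** Every finite set of frequencies lies in a box. *)
Lemma esum_le_sum_box (F : int * int -> R) M : (forall p, 0 <= F p) ->
  (forall N, \sum_(p <- box N) F p <= M) ->
  (\esum_(p in [set: int * int]) (F p)%:E <= M%:E)%E.
Proof.
move=> F0 FM; apply: ge_ereal_sup => _ [X [fX _] <-].
have [s sX us] : exists2 s : seq (int * int), X = [set` s] & uniq s.
  have /finite_seqP[s0 ->] := fX; exists (undup s0); last exact: undup_uniq.
  by apply/seteqP; split => x /=; rewrite mem_undup.
pose N := (\max_(p <- s) (absz p.1 + absz p.2))%N.
have sN : {subset s <= box N}.
  move=> p ps; have : (absz p.1 + absz p.2 <= N)%N by apply: leq_bigmax_seq.
  by rewrite mem_box; move: (N) (p.1) (p.2) => n k l; lia.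
rewrite sX -fsbig_seq// sumEFin lee_fin (le_trans _ (FM N))//.
rewrite [leRHS](bigID (mem s) xpredT)/= [leLHS](_ : _ = \sum_(p <- box N | p \in s) F p).
  by rewrite lerDl sumr_ge0.
rewrite -[RHS]big_filter; apply: perm_big; apply: uniq_perm => //.
  by rewrite filter_uniq// uniq_box.
by move=> p; rewrite mem_filter; case: (boolP (p \in s)) => // /sN ->.
Qed.

Lemma Hsqnorm_ge0 s v : (0 <= Hsqnorm s v)%E.
Proof. by rewrite HsqnormE; apply: esum_ge0 => p _; rewrite lee_fin mulr_ge0 ?powR_ge0 ?fsqr_ge0. Qed.

(** By this estimate the continuity of the solution with values in H^s is
    passed on to its gradient and to Delta H + H. *)
Lemma dot_le_Hsqnorm (s : R) v w : L2 w -> (Hsqnorm s v < +oo)%E ->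
  (forall p, fsqr w p <= (1 + lam p) `^ s * fsqr v p) ->
  dot w w <= 4 * pi ^+ 2 * fine (Hsqnorm s v).
Proof.
move=> Lw fin wv.
have fN : Hsqnorm s v \is a fin_num by rewrite ge0_fin_numE// Hsqnorm_ge0.
rewrite mulrC -ler_pdivrMr ?mulr_gt0 ?exprn_gt0 ?pi_gt0// mulrC.
apply: (cvgr_to_le (Parseval Lw Lw)); apply: nearW => N.
rewrite -lee_fin fineK// HsqnormE (le_trans _ (sum_box_le_esum N _))//.
  by rewrite lee_fin; apply: ler_sum => p _; rewrite fpair_diag.
by move=> p; rewrite mulr_ge0 ?powR_ge0 ?fsqr_ge0.
Qed.

Lemma powR_ge_sqr (s x : R) : 2 <= s -> 1 <= x -> x ^+ 2 <= x `^ s.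
Proof.
by move=> s2 x1; rewrite -powR_mulrn ?(le_trans _ x1)//; exact: ler_powR.
Qed.

End WeakDerivatives.

(** * The energy and the distance to the steady states *)

Section Energy.
Variable R : realType.
Implicit Types (f g u v w : R * R -> R) (k l : int) (a : R) (p : int * int).

(** E[v] for v of mean m and gradient (g1, g2). *)
Definition energy (m : R) v g1 g2 : R :=
  2^-1 * (dot g1 g1 + dot g2 g2 - dot v v) + 2 * pi ^+ 2 * m ^+ 2.

(** The coefficients that survive after removing the mean and the modes with
    lam = 1, see [fsqr_Pge2]. *)
Definition high v p : R := if 2 <= lam R p then fsqr v p else 0.

Lemma high_ge0 v p : 0 <= high v p.
Proof. by rewrite /high; case: ifP => // _; exact: fsqr_ge0. Qed.

Lemma fsqr00 v : L2 v -> fsqr v (0, 0) = mean v ^+ 2.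
Proof. by move=> Lv; rewrite /fsqr fIm00// expr0n addr0 meanE. Qed.

Lemma box00 N : (0, 0) \in box N.
Proof. by rewrite mem_box/= normr0 lez_nat. Qed.

Lemma lam1_neq0 p : lam R p = 1 -> p != (0, 0).
Proof.
move=> l1; apply/eqP => p0; move: l1; rewrite p0 lam00 => /eqP.
by rewrite eq_sym oner_eq0.
Qed.

Lemma lam2_neq0 p : 2 <= lam R p -> p != (0, 0).
Proof. by apply: contraTneq => ->; rewrite lam00 -ltNge. Qed.

(** The weight lam - 1 vanishes on the modes with lam = 1 and is - 1 on the mean;
    the latter is what the term 2 pi^2 m^2 of the energy compensates. *)
Lemma high_split v p : L2 v -> (lam R p - 1) * high v p =
  (lam R p - 1) * fsqr v p + (if p == (0, 0) then mean v ^+ 2 else 0).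
Proof.
move=> Lv; rewrite /high; have [->|l1|l2] := lam_cases R p.
- by rewrite eqxx lam00 fsqr00// lern0/=; ring.
- by rewrite l1 (negbTE (lam1_neq0 l1)); ring.
- by rewrite l2 (negbTE (lam2_neq0 l2)) addr0.
Qed.

Lemma cvg_energy v g1 g2 : is_grad v g1 g2 ->
  \sum_(p <- box N) (lam R p - 1) * high v p @[N --> \oo] -->
    (2 * pi ^+ 2)^-1 * energy (mean v) v g1 g2.
Proof.
move=> gv; have [Lv Lg1 Lg2] := L2_grad gv.
have c := cvgD (cvgB (cvgD (Parseval Lg1 Lg1) (Parseval Lg2 Lg2)) (Parseval Lv Lv))
  (cvg_cst (mean v ^+ 2)).
have -> : (2 * pi ^+ 2)^-1 * energy (mean v) v g1 g2 =
   (4 * pi ^+ 2)^-1 * dot g1 g1 + (4 * pi ^+ 2)^-1 * dot g2 g2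
   - (4 * pi ^+ 2)^-1 * dot v v + mean v ^+ 2.
  by rewrite /energy; have := pi_neq0 R; move: pi => c0 c1; field.
rewrite (_ : (fun N => _) = (fun N => \sum_(p <- box N) fpair g1 g1 p
  + \sum_(p <- box N) fpair g2 g2 p - \sum_(p <- box N) fpair v v p + mean v ^+ 2)).
  exact: c.
apply/funext => N; rewrite -big_split/= -sumrB.
rewrite -[mean v ^+ 2](sum_box_at (fun=> mean v ^+ 2) (box00 N)) -big_split/=.
apply: eq_bigr => p _; rewrite high_split// !fpair_diag (fsqr_grad _ gv).
by rewrite mulrBl mul1r.
Qed.

Lemma sum_box_mono (F : int * int -> R) N M : (forall p, 0 <= F p) ->
  (N <= M)%N -> \sum_(p <- box N) F p <= \sum_(p <- box M) F p.
Proof.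
move=> F0 NM; rewrite [leRHS](bigID (mem (box N)) xpredT)/=.
rewrite -[leLHS]addr0 lerD//; last by apply: sumr_ge0 => p _.
rewrite -[leRHS]big_filter le_eqVlt; apply/orP; left; apply/eqP.
apply: perm_big; apply: uniq_perm; rewrite ?filter_uniq ?uniq_box//.
move=> p; rewrite mem_filter; case: (boolP (p \in box N)) => //.
by rewrite !mem_box => /andP[h1 h2]; apply/esym/andP; split; lia.
Qed.

Lemma sum_high_le_energy v g1 g2 N : is_grad v g1 g2 ->
  \sum_(p <- box N) (lam R p - 1) * high v p <=
    (2 * pi ^+ 2)^-1 * energy (mean v) v g1 g2.
Proof.
move=> gv; apply: (cvgr_to_ge (cvg_energy gv)); exists N => // M /= NM.
apply: sum_box_mono => // p; rewrite /high; case: ifP => [h|_]; last by rewrite mulr0.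
by rewrite mulr_ge0 ?fsqr_ge0//; lra.
Qed.

Lemma Bessel v N : L2 v -> \sum_(p <- box N) fsqr v p <= (4 * pi ^+ 2)^-1 * dot v v.
Proof.
move=> Lv; apply: (cvgr_to_ge (Parseval Lv Lv)); exists N => // M /= NM.
under [leRHS]eq_bigr do rewrite fpair_diag.
by apply: sum_box_mono => // p; exact: fsqr_ge0.
Qed.

(** Every eigenvalue lam >= 2 satisfies lam (lam - 1) >= 2. *)
Lemma coercive v g1 g2 q q1 q2 : is_grad v g1 g2 -> pressure v q ->
  is_grad q q1 q2 ->
  4 * energy (mean v) v g1 g2 <= dot q1 q1 + dot q2 q2.
Proof.
move=> gv [_ _ qv] gq; have [Lv Lg1 Lg2] := L2_grad gv; have [_ Lq1 Lq2] := L2_grad gq.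
have c1 : 2 * (\sum_(p <- box N) (lam R p - 1) * high v p) @[N --> \oo] -->
    2 * ((2 * pi ^+ 2)^-1 * energy (mean v) v g1 g2).
  by apply: cvgM; [exact: cvg_cst|exact: cvg_energy].
have c2 : \sum_(p <- box N) fpair q1 q1 p + \sum_(p <- box N) fpair q2 q2 p
    @[N --> \oo] --> (4 * pi ^+ 2)^-1 * dot q1 q1 + (4 * pi ^+ 2)^-1 * dot q2 q2.
  by apply: cvgD; exact: Parseval.
have h : 2 * ((2 * pi ^+ 2)^-1 * energy (mean v) v g1 g2) <=
  (4 * pi ^+ 2)^-1 * dot q1 q1 + (4 * pi ^+ 2)^-1 * dot q2 q2.
  apply: (ler_cvg_to c1 c2); apply: nearW => N /=.
  rewrite -big_split/= mulr_sumr; apply: ler_sum => p _.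
  rewrite !fpair_diag (fsqr_grad _ gq) /high.
  have -> : fsqr q p = (1 - lam R p) ^+ 2 * fsqr v p.
    by rewrite /fsqr (qv p).1 (qv p).2; ring.
  have l0 := lam_ge0 R p; have f0 := fsqr_ge0 v p.
  case: ifP => h; last first.
    by rewrite !mulr0 mulr_ge0// mulr_ge0// sqr_ge0.
  rewrite !mulrA ler_wpM2r//.
  have : 0 <= (lam R p - 1) * (lam R p - 2) * (lam R p + 1).
    by rewrite mulr_ge0// ?mulr_ge0//; lra.
  by lra.
move: h; rewrite -mulrDr.
have -> : 2 * ((2 * pi ^+ 2)^-1 * energy (mean v) v g1 g2) =
  (4 * pi ^+ 2)^-1 * (4 * energy (mean v) v g1 g2).
  by have := pi_neq0 R; move: (energy _ _ _ _); move: pi => c0 E c3; field.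
by rewrite ler_pM2l// invr_gt0 mulr_gt0// exprn_gt0// pi_gt0.
Qed.

(** Integration by parts in the Dirichlet integral. *)
Lemma energy_pressure v g1 g2 q : is_grad v g1 g2 -> pressure v q ->
  energy (mean v) v g1 g2 = - (2^-1 * dot q v) + 2 * pi ^+ 2 * mean v ^+ 2.
Proof.
move=> gv [_ Lq qv]; have [Lv Lg1 Lg2] := L2_grad gv.
rewrite /energy; congr (_ + _); rewrite -mulrN; congr (_ * _).
have c1 : \sum_(p <- box N) fpair g1 g1 p + \sum_(p <- box N) fpair g2 g2 p
   - \sum_(p <- box N) fpair v v p @[N --> \oo] --> (4 * pi ^+ 2)^-1 * dot g1 g1
   + (4 * pi ^+ 2)^-1 * dot g2 g2 - (4 * pi ^+ 2)^-1 * dot v v.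
  by apply: cvgB; [apply: cvgD|]; exact: Parseval.
have c2 : - \sum_(p <- box N) fpair q v p @[N --> \oo] -->
    - ((4 * pi ^+ 2)^-1 * dot q v).
  by apply: cvgN; exact: Parseval.
have E : (fun N => \sum_(p <- box N) fpair g1 g1 p + \sum_(p <- box N) fpair g2 g2 p
   - \sum_(p <- box N) fpair v v p) = (fun N => - \sum_(p <- box N) fpair q v p).
  apply/funext => N; rewrite -big_split/= -sumrB -sumrN; apply: eq_bigr => p _.
  by rewrite !fpair_diag (fsqr_grad _ gv) /fpair (qv p).1 (qv p).2 /fsqr; ring.
rewrite E in c1; have := cvg_unique (@Rhausdorff R) c1 c2.
rewrite -mulrDr -mulrBr -mulrN => h.
exact: (mulfI (invr_neq0 (@pi4_neq0 R)) (h _)).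
Qed.

(** ** Removing the mean and the first modes *)

Lemma projline_mode k l a v : L2 v -> (k, l) != (0, 0) ->
  projline (mode k l a) v = fun x =>
    (2 * (cos a * fRe v (k, l) + sin a * fIm v (k, l))) * mode k l a x.
Proof.
move=> Lv kl; apply/funext => x; rewrite /projline; congr (_ * _).
rewrite -[dotT2 v _]/(dot v (mode k l a)) -[dotT2 _ _]/(dot (mode k l a) (mode k l a)).
rewrite dot_modeE// dot_mode !eqxx/= subrr cos0.
have -> : (k == - k) && (l == - l) = false.
  by apply/negbTE; move: kl; rewrite xpair_eqE; apply: contra => /andP[h1 h2]; lia.
by have := pi_neq0 R; move: (fRe _ _) (fIm _ _) (cos _) (sin _); move: pi => *; field.
Qed.

Lemma P1E v : L2 v -> P1 v = fun x =>
  (2 * fRe v (1, 0)) * mode 1 0 0 x + (2 * fIm v (1, 0)) * mode 1 0 (pi / 2) x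
  + (2 * fRe v (0, 1)) * mode 0 1 0 x.
Proof.
move=> Lv; apply/funext => x; rewrite /P1.
have e1 : (fun y : R * R => cos y.1) = mode 1 0 0.
  by apply/funext => y; rewrite /mode mulr1z mul1r mulr0z mul0r !addr0.
have e2 : (fun y : R * R => sin y.1) = mode 1 0 (- (pi / 2)).
  by apply/funext => y; rewrite /mode mulr1z mul1r mulr0z mul0r addr0 cosBpihalf.
have e3 : (fun y : R * R => cos y.2) = mode 0 1 0.
  by apply/funext => y; rewrite /mode mulr1z mul1r mulr0z mul0r addr0 add0r.
rewrite e1 e2 e3 !projline_mode// cos0 sin0 cosN sinN cos_pihalf sin_pihalf.
rewrite {2}/mode cosBpihalf [X in _ = _ + _ * X + _]/mode cosDpihalf; ring.
Qed.

Definition low_modes : seq (int * int) :=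
  [:: (0, 0); (1, 0); (-1, 0); (0, 1); (0, -1)].

Lemma mem_low_modes p : (p \in low_modes) = ~~ (2 <= lam R p).
Proof.
have E : lam R p = (p.1 ^+ 2 + p.2 ^+ 2)%:~R by rewrite /lam intrD !rmorphXn.
rewrite E (_ : 2 = 2%:~R)// ler_int -ltNge; case: p {E} => k l /=.
apply/idP/idP => [|h].
  by rewrite !inE !xpair_eqE => /orP[|/orP[|/orP[|/orP[]]]] /andP[/eqP-> /eqP->].
have hk : -1 <= k <= 1 by apply/andP; split; nia.
have hl : -1 <= l <= 1 by apply/andP; split; nia.
rewrite !inE !xpair_eqE.
have : k = -1 \/ k = 0 \/ k = 1 by lia.
have : l = -1 \/ l = 0 \/ l = 1 by lia.
by move=> el ek; move: h; case: el => [->|[->|->]]; case: ek => [->|[->|->]].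
Qed.

(** P_1 contains no sine of zeta; the corresponding coefficient of v vanishes
    because v is even in zeta. *)
Lemma fsqr_Pge2 v p : L2ev v -> fsqr (Pge2 (mean v) v) p = high v p.
Proof.
move=> [/L2T2_L2 Lv ev].
have Lm k l a c : L2 (fun x => c * mode k l a x : R).
  by apply: sqintZ => //; exact: L2_mode.
have im01 : fIm v (0, 1) = 0.
  have := ev 0 1; rewrite (fourierE v (0, 1)) (fourierE v (0, -1)) => /eqP.
  rewrite eq_complex/= => /andP[_ /eqP h].
  have := fIm_opp (0, 1) Lv; rewrite /= oppr0 -h; move: (fIm _ _) => y; lra.
have E : Pge2 (mean v) v = (fun x => v x - mean v * mode 0 0 0 x -
  ((2 * fRe v (1, 0)) * mode 1 0 0 x + (2 * fIm v (1, 0)) * mode 1 0 (pi / 2) x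
  + (2 * fRe v (0, 1)) * mode 0 1 0 x)).
  apply/funext => x; rewrite /Pge2 P1E//; congr (_ - _ - _).
  by rewrite /mode !mulr0z !mul0r !addr0 cos0 mulr1.
have LP : L2 (fun x => (2 * fRe v (1, 0)) * mode 1 0 0 x + (2 * fIm v (1, 0)) * mode 1 0 (pi / 2) x
  + (2 * fRe v (0, 1)) * mode 0 1 0 x).
  by apply: sqintD => //; apply: sqintD.
have L2m := sqintB mS Lv (Lm 0 0 0 (mean v)).
have LPP := sqintD mS (Lm 1 0 0 (2 * fRe v (1, 0))) (Lm 1 0 (pi / 2) (2 * fIm v (1, 0))).
have r1 : fRe v (-1, 0) = fRe v (1, 0) by rewrite -(fRe_opp v (1, 0))/= oppr0.
have r2 : fRe v (0, -1) = fRe v (0, 1) by rewrite -(fRe_opp v (0, 1))/= oppr0.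
have i1 : fIm v (-1, 0) = - fIm v (1, 0).
  by rewrite -(fIm_opp (1, 0) Lv)/= oppr0.
have i2 : fIm v (0, -1) = - fIm v (0, 1).
  by rewrite -(fIm_opp (0, 1) Lv)/= oppr0.
have not_low q : 2 <= lam R p -> q \in low_modes -> p != q.
  by rewrite mem_low_modes => h; apply: contraNneq => <-.
have re : fRe (Pge2 (mean v) v) p = if 2 <= lam R p then fRe v p else 0.
  rewrite E fReB// fReB// fReD// fReD// !fReZ; try exact: L2_mode.
  rewrite !fRe_mode cos0 cos_pihalf !oppr0; have [h|h] := boolP (2 <= lam R p).
    rewrite !(negbTE (not_low _ h _)) ?inE//; ring.
  have := h; rewrite -mem_low_modes !inE.
  by move=> /orP[|/orP[|/orP[|/orP[]]]] /eqP->; rewrite ?r1 ?r2 ?meanE/=; field.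
have im : fIm (Pge2 (mean v) v) p = if 2 <= lam R p then fIm v p else 0.
  rewrite E fImB// fImB// fImD// fImD// !fImZ; try exact: L2_mode.
  rewrite !fIm_mode sin0 sin_pihalf !oppr0; have [h|h] := boolP (2 <= lam R p).
    rewrite !(negbTE (not_low _ h _)) ?inE//; ring.
  have := h; rewrite -mem_low_modes !inE.
  by move=> /orP[|/orP[|/orP[|/orP[]]]] /eqP->;
    rewrite ?i1 ?i2 ?im01 ?fIm00//=; field.
rewrite /fsqr re im /high; case: ifP => //; by rewrite expr0n addr0.
Qed.

End Energy.

Section Distance.
Variable R : realType.
Implicit Types (f g u v w : R * R -> R) (k l : int) (a : R) (p : int * int).

Lemma Hsqnorm1_Pge2 v : L2ev v -> Hsqnorm 1 (Pge2 (mean v) v) =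
  (\esum_(p in [set: int * int]) ((1 + lam R p) * high v p)%:E)%E.
Proof.
move=> ev; rewrite HsqnormE; apply: eq_esum => p _.
by rewrite fsqr_Pge2// powRr1// addr_ge0// lam_ge0.
Qed.

Lemma one_lam_high_ge0 v p : 0 <= (1 + lam R p) * high v p.
Proof. by rewrite mulr_ge0 ?high_ge0// addr_ge0// lam_ge0. Qed.

(** 1 + lam <= 3 (lam - 1) for lam >= 2. *)
Lemma distH1_sqr_le v g1 g2 : L2ev v -> is_grad v g1 g2 ->
  distH1_steady (mean v) v ^+ 2 <= 3 * ((2 * pi ^+ 2)^-1 * energy (mean v) v g1 g2).
Proof.
move=> ev gv; have ge0 := Hsqnorm_ge0 1 (Pge2 (mean v) v).
rewrite /distH1_steady /Hnorm sqr_sqrtr ?fine_ge0//.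
have le : (Hsqnorm 1 (Pge2 (mean v) v) <=
    (3 * ((2 * pi ^+ 2)^-1 * energy (mean v) v g1 g2))%:E)%E.
  rewrite Hsqnorm1_Pge2//; apply: esum_le_sum_box; first exact: one_lam_high_ge0.
  move=> N; rewrite -ler_pdivrMl//; apply: le_trans (sum_high_le_energy N gv).
  rewrite mulr_sumr; apply: ler_sum => p _; rewrite /high; case: ifP => h; last first.
    by rewrite !mulr0.
  by rewrite mulrA ler_wpM2r ?fsqr_ge0//; lra.
by rewrite -lee_fin fineK// ge0_fin_numE// (le_lt_trans le)// ltry.
Qed.

(** lam - 1 <= 1 + lam; the finite norm of order s makes the H^1 norm of
    P_(>= 2) v a genuine real number, which is not the default value of [fine]. *)
Lemma energy_le_distH1 v g1 g2 s : L2ev v -> is_grad v g1 g2 -> 1 <= s ->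
  (Hsqnorm s v < +oo)%E ->
  (2 * pi ^+ 2)^-1 * energy (mean v) v g1 g2 <= distH1_steady (mean v) v ^+ 2.
Proof.
move=> ev gv s1 fin; have ge0 := Hsqnorm_ge0 1 (Pge2 (mean v) v).
rewrite /distH1_steady /Hnorm sqr_sqrtr ?fine_ge0//.
have fin1 : (Hsqnorm 1 (Pge2 (mean v) v) < +oo)%E.
  apply: le_lt_trans fin; rewrite !HsqnormE; apply: le_esum => p _.
  rewrite lee_fin fsqr_Pge2//; apply: ler_pM.
  - exact: powR_ge0.
  - exact: high_ge0.
  - by apply: ler_powR => //; rewrite lerDl lam_ge0.
  - by rewrite /high; case: ifP => // _; exact: fsqr_ge0.
apply: (cvgr_to_le (cvg_energy gv)); apply: nearW => N.
rewrite -lee_fin fineK ?ge0_fin_numE// Hsqnorm1_Pge2//.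
apply: le_trans (sum_box_le_esum N (one_lam_high_ge0 v)); rewrite lee_fin.
by apply: ler_sum => p _; rewrite ler_wpM2r ?high_ge0//; lra.
Qed.

(** ** Pointwise size of a non-negative function from its Fourier coefficients *)

Lemma fRe00 v : fRe v (0, 0) = (4 * pi ^+ 2)^-1 * intT2 v.
Proof.
rewrite /fRe -dot1; congr (_ * dot _ _); apply/funext => x.
by rewrite /mode !mulr0z !mul0r !addr0 cos0.
Qed.

Lemma L2_fourier_comb a b k l : L2 (fun x : R * R =>
   a * mode k l 0 x + b * mode k l (pi / 2) x).
Proof. by apply: sqintD => //; apply: sqintZ => //; exact: L2_mode. Qed.

(** With r = |g_p|, the number 4 pi^2 r^2 is the integral of g against a
    cosine of amplitude r, hence at most r times the integral of g. *)
Lemma sqrt_fsqr_le g p : L2 g -> (forall x, sq x -> 0 <= g x) ->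
  Num.sqrt (fsqr g p) <= fRe g (0, 0).
Proof.
move=> Lg g0; set r := Num.sqrt _.
have r0 : 0 <= r by exact: sqrtr_ge0.
have g00 : 0 <= fRe g (0, 0).
  rewrite fRe00 mulr_ge0 ?invr_ge0 ?mulr_ge0 ?exprn_ge0 ?pi_ge0//.
  exact: Rintegral_ge0.
have rr : r ^+ 2 = fsqr g p by rewrite sqr_sqrtr// fsqr_ge0.
suff h : r ^+ 2 <= r * fRe g (0, 0).
  have [->//|rN] := eqVneq r 0.
  by move: h; rewrite expr2 ler_pM2l// lt_neqAle eq_sym rN.
have -> : r ^+ 2 = (4 * pi ^+ 2)^-1 *
   dot (fun x => fRe g p * mode p.1 p.2 0 x + fIm g p * mode p.1 p.2 (pi / 2) x) g.
  rewrite ipC ipDr//; try by apply: sqintZ => //; exact: L2_mode.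
  rewrite !ipZr//; try exact: L2_mode.
  by rewrite rr mulrDr (mulrCA _ (fRe g p)) (mulrCA _ (fIm g p)).
rewrite fRe00 [leRHS]mulrCA ler_pM2l ?invr_gt0 ?mulr_gt0 ?exprn_gt0 ?pi_gt0//.
rewrite -dot1 ipC -ipZr//; last exact: L2_cst.
apply: le_Rintegral => //.
- by apply: integrable_mul => //; exact: L2_fourier_comb.
- by apply: integrable_mul => //; apply: sqintZ => //; exact: L2_cst.
move=> x sx; rewrite mulr1 ler_wpM2l ?g0//.
set c := mode _ _ 0 _; set d := mode _ _ (pi / 2) _.
have cd : c ^+ 2 + d ^+ 2 = 1.
  by rewrite /c /d /mode addr0 cosDpihalf sqrrN cos2Dsin2.
have := sqr_ge0 (fRe g p * d - fIm g p * c) => h.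
have : (fRe g p * c + fIm g p * d) ^+ 2 <= r ^+ 2.
  have -> : r ^+ 2 = (fRe g p ^+ 2 + fIm g p ^+ 2) * (c ^+ 2 + d ^+ 2).
    by rewrite cd mulr1 rr.
  by rewrite -subr_ge0; move: h; congr (_ <= _); ring.
by move=> h2; rewrite (le_trans (ler_norm _))// -ler_sqr ?nnegrE// real_normK ?num_real.
Qed.

(** A function with absolutely summable Fourier series is bounded by the sum of
    the moduli; this is the form of it that needs no pointwise convergence. *)
Lemma dot_le_sum_coefs v g M : L2 v -> L2 g -> (forall x, sq x -> 0 <= g x) ->
  (forall N, \sum_(p <- box N) Num.sqrt (fsqr v p) <= M) ->
  dot v g <= M * intT2 g.
Proof.
move=> Lv Lg g0 vM.
rewrite -(ler_pM2l (_ : 0 < (4 * pi ^+ 2)^-1)); last first.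
  by rewrite invr_gt0 ?mulr_gt0 ?exprn_gt0 ?pi_gt0.
rewrite [leRHS]mulrCA -(fRe00 g); apply: (cvgr_to_le (Parseval Lv Lg)); apply: nearW => N.
have g00 : 0 <= fRe g (0, 0) by rewrite (le_trans _ (sqrt_fsqr_le (0, 0) Lg g0)).
apply: (@le_trans _ _ (\sum_(p <- box N) Num.sqrt (fsqr v p) * fRe g (0, 0))); last first.
  by rewrite -mulr_suml ler_wpM2r.
apply: ler_sum => p _.
apply: (@le_trans _ _ (Num.sqrt (fsqr v p) * Num.sqrt (fsqr g p))); last first.
  by rewrite ler_wpM2l ?sqrtr_ge0// sqrt_fsqr_le.
rewrite -sqrtrM ?fsqr_ge0// (le_trans (ler_norm _))// -sqrtr_sqr ler_wsqrtr//.
rewrite -subr_ge0 /fpair /fsqr.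
have := sqr_ge0 (fRe v p * fIm g p - fIm v p * fRe g p).
by congr (_ <= _); ring.
Qed.

(** The bound telescopes: 2 / (1 + n^2) <= 4 / n - 4 / (n + 1) for n >= 1. *)
Lemma sum_inv_sqr N :
  \sum_(k <- int_range N) (1 + k%:~R ^+ 2)^-1 <= 5 - 4 / N.+1%:R :> R.
Proof.
elim: N => [|N IH].
  rewrite /int_range/= big_cons big_nil subrr mulr0z expr0n !addr0 invr1 mulr1; lra.
have -> : \sum_(k <- int_range N.+1) (1 + k%:~R ^+ 2)^-1 =
   (1 + N.+1%:R ^+ 2)^-1 + ((1 + N.+1%:R ^+ 2)^-1
   + \sum_(k <- int_range N) (1 + k%:~R ^+ 2)^-1) :> R.
  have P : perm_eq (int_range N.+1) [:: N.+1%:Z, - N.+1%:Z & int_range N].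
    apply: uniq_perm; rewrite ?uniq_int_range//.
      rewrite 2!cons_uniq uniq_int_range andbT inE !mem_int_range; lia.
    by move=> k; rewrite [LHS]mem_int_range 2!in_cons mem_int_range; lia.
  by rewrite (perm_big _ P)/= !big_cons mulrNz sqrrN.
have n0 : (0 : R) <= N%:R by [].
have E1 : N.+1%:R = N%:R + 1 :> R by rewrite natr1.
have E2 : N.+2%:R = N%:R + 1 + 1 :> R by rewrite !natr1.
rewrite E2 E1; rewrite E1 in IH; move: IH n0 {E1 E2}; move: (N%:R) => n IH n0.
move: IH; set S := \sum_(_ <- _) _; move: S => S IH.
have h : 2 * (1 + (n + 1) ^+ 2)^-1 <= 4 / (n + 1) - 4 / (n + 1 + 1).
  have -> : 4 / (n + 1) - 4 / (n + 1 + 1) = 4 / ((n + 1) * (n + 1 + 1)).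
    by field; apply/andP; split; rewrite gt_eqF//; lra.
  rewrite ler_pdivlMr; last by rewrite mulr_gt0//; lra.
  by rewrite mulrAC ler_pdivrMr; nra.
by lra.
Qed.

Lemma sum_box_prod N (F G : int -> R) : \sum_(p <- box N) F p.1 * G p.2 =
  (\sum_(k <- int_range N) F k) * (\sum_(l <- int_range N) G l).
Proof.
rewrite /box big_allpairs_dep/= mulr_suml; apply: eq_bigr => k _.
by rewrite mulr_sumr.
Qed.

(** (1 + k^2) (1 + l^2) <= lam^2 <= 2 lam (lam - 1)^2 for lam >= 2, which reduces
    the double series to the square of a simple one. *)
Lemma sum_box_weights N :
  \sum_(p <- box N) (if 2 <= lam R p then (lam R p * (lam R p - 1) ^+ 2)^-1 else 0)
    <= 50 :> R.
Proof.
apply: (@le_trans _ _ (\sum_(p <- box N)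
   (2 * (1 + p.1%:~R ^+ 2)^-1) * (1 + p.2%:~R ^+ 2)^-1)); last first.
  rewrite (sum_box_prod N (fun k => 2 * (1 + k%:~R ^+ 2)^-1)
    (fun l => (1 + l%:~R ^+ 2)^-1)) -mulr_sumr.
  have S5 : \sum_(k <- int_range N) (1 + k%:~R ^+ 2)^-1 <= 5 :> R.
    by rewrite (le_trans (sum_inv_sqr N))// gerDl oppr_le0 divr_ge0.
  have S0 : 0 <= \sum_(k <- int_range N) (1 + k%:~R ^+ 2)^-1 :> R.
    by apply: sumr_ge0 => k _; rewrite invr_ge0 addr_ge0// sqr_ge0.
  by nra.
apply: ler_sum => -[k l] _ /=; rewrite /lam/=.
move: (k%:~R) (l%:~R) => x y; have := sqr_ge0 x; have := sqr_ge0 y.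
move: (x ^+ 2) (y ^+ 2) => {}x {}y y0 x0; case: ifP => h; last first.
  by rewrite mulr_ge0 ?invr_ge0 ?mulr_ge0// ?invr_ge0; lra.
rewrite -mulrA -invfM -[leLHS]mul1r ler_pdivrMr; last by rewrite mulr_gt0// ?exprn_gt0//; lra.
rewrite mulrAC ler_pdivlMr; last by rewrite mulr_gt0//; lra.
rewrite mul1r.
have h1 : (1 + x) * (1 + y) <= (x + y) ^+ 2.
  have := sqr_ge0 (x - y); nra.
have h2 : (x + y) ^+ 2 <= 2 * ((x + y) * (x + y - 1)) by nra.
have h3 : (x + y) * (x + y - 1) <= (x + y) * (x + y - 1) ^+ 2 by nra.
by lra.
Qed.

End Distance.

(** * The energy inequality *)

Section Dissipation.
Variable R : realType.
Implicit Types (f g u v w : R * R -> R) (k l : int) (a : R) (p : int * int).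

Lemma sum_box_low (m : R) N : 0 <= m ->
  \sum_(p <- box N) (if 2 <= lam R p then 0 else m) <= 5 * m.
Proof.
move=> m0; rewrite (eq_bigr (fun p => if p \in low_modes then m else 0)); last first.
  by move=> p _; rewrite (mem_low_modes R); case: (2 <= _).
rewrite -big_mkcond -big_filter big_const_seq count_predT iter_addr_0 -[leLHS]mulr_natl.
rewrite ler_wpM2r// ler_nat -[5%N]/(size low_modes).
apply: uniq_leq_size; first by rewrite filter_uniq ?uniq_box.
by move=> p; rewrite mem_filter => /andP[].
Qed.

(** The coefficients with lam <= 1 are bounded by the mean because v >= 0, and
    the other ones are summed by the Cauchy-Schwarz inequality against the
    convergent weights 1 / (lam (lam - 1)^2). *)
Lemma sum_coefs_le v q q1 q2 : L2 v -> (forall x, sq x -> 0 <= v x) ->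
  0 < mean v -> pressure v q -> is_grad q q1 q2 ->
  exists M, [/\ 0 <= M, forall N, \sum_(p <- box N) Num.sqrt (fsqr v p) <= M &
    M ^+ 2 <= 163 * mean v ^+ 2
              + 113 * ((4 * pi ^+ 2)^-1 * (dot q1 q1 + dot q2 q2))].
Proof.
move=> Lv v0 m0 [_ Lq qv] gq; have [_ Lq1 Lq2] := L2_grad gq.
set m := mean v in m0 *; set X := _^-1 * _.
have X0 : 0 <= X.
  by rewrite mulr_ge0 ?invr_ge0 ?mulr_ge0 ?exprn_ge0 ?pi_ge0 ?addr_ge0 ?ip_ge0.
have Xm : 0 < X + m ^+ 2 by rewrite ltr_wpDl// exprn_gt0.
(* m^2 is added to make r positive, as r is a denominator below *)
set r := Num.sqrt (X + m ^+ 2); have r0 : 0 < r by rewrite sqrtr_gt0.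
have rr : r ^+ 2 = X + m ^+ 2 by rewrite sqr_sqrtr// ltW.
exists (5 * m + 15 / 2 * r); split.
- by rewrite addr_ge0// mulr_ge0// ?ltW// divr_gt0.
- move=> N.
  (* y <= (c W y^2 + 1 / (c W)) / 2 with c = 5 / r, which balances the bound r^2
     for the sum of W y^2 and the bound 50 for the sum of 1 / W *)
  pose W p := lam R p * (lam R p - 1) ^+ 2.
  have T p : Num.sqrt (fsqr v p) <= (if 2 <= lam R p then 0 else m)
      + (5 / r / 2 * (fsqr q1 p + fsqr q2 p)
         + r / 10 * (if 2 <= lam R p then (W p)^-1 else 0)).
    rewrite (fsqr_grad _ gq); have -> : fsqr q p = (1 - lam R p) ^+ 2 * fsqr v p.
      by rewrite /fsqr (qv p).1 (qv p).2; ring.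
    have E : lam R p * ((1 - lam R p) ^+ 2 * fsqr v p) = W p * fsqr v p.
      by rewrite /W; ring.
    rewrite E; set y := Num.sqrt _.
    have yy : fsqr v p = y ^+ 2 by rewrite sqr_sqrtr// fsqr_ge0.
    case: ifP => h; last first.
      have W0 : 0 <= W p by rewrite mulr_ge0 ?lam_ge0// sqr_ge0.
      rewrite mulr0 addr0 (le_trans (sqrt_fsqr_le p Lv v0))// -meanE lerDl.
      by rewrite mulr_ge0 ?(mulr_ge0 W0 (fsqr_ge0 _ _))// divr_ge0// divr_ge0// ltW.
    have W0 : 0 < W p by rewrite mulr_gt0 ?exprn_gt0//; lra.
    rewrite add0r yy -subr_ge0.
    have -> : 5 / r / 2 * (W p * y ^+ 2) + r / 10 * (W p)^-1 - y =
       (5 * W p * y - r) ^+ 2 / (10 * r * W p).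
      by field; rewrite !gt_eqF.
    have Wr : 0 <= 10 * r * W p.
      by apply: mulr_ge0; [apply: mulr_ge0 => //; exact: ltW|exact: ltW].
    exact: divr_ge0 (sqr_ge0 _) Wr.
  apply: (le_trans (ler_sum _ (fun p _ => T p))).
  rewrite big_split/= lerD ?sum_box_low ?(ltW m0)//.
  rewrite big_split/= -!mulr_sumr big_split/=.
  have b1 : \sum_(p <- box N) fsqr q1 p + \sum_(p <- box N) fsqr q2 p <= X.
    by rewrite /X mulrDr lerD// Bessel.
  have b2 := sum_box_weights R N.
  have h1 : 5 / r / 2 * (\sum_(p <- box N) fsqr q1 p + \sum_(p <- box N) fsqr q2 p)
      <= 5 / 2 * r.
    rewrite (_ : 5 / 2 * r = 5 / r / 2 * r ^+ 2); last by field; rewrite gt_eqF.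
    rewrite ler_wpM2l ?divr_ge0 ?(ltW r0)// rr (le_trans b1)// lerDl.
    by rewrite sqr_ge0.
  have h2 : r / 10 * \sum_(p <- box N) (if 2 <= lam R p then (W p)^-1 else 0)
      <= 5 * r.
    rewrite (_ : 5 * r = r / 10 * 50); last by field.
    by rewrite ler_wpM2l ?divr_ge0 ?(ltW r0).
  by rewrite (le_trans (lerD h1 h2))// le_eqVlt; apply/orP; left; apply/eqP; field.
- have : (5 * m + 15 / 2 * r) ^+ 2 <= 50 * m ^+ 2 + 225 / 2 * r ^+ 2.
    by have := sqr_ge0 (5 * m - 15 / 2 * r); lra.
  by rewrite rr => h; have := sqr_ge0 m; lra.
Qed.

Lemma intT2_le f g : L2 f -> L2 g -> (forall x, sq x -> f x <= g x) ->
  intT2 f <= intT2 g.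
Proof.
by move=> Lf Lg fg; apply: le_Rintegral => //; exact: L2_integrable.
Qed.

Lemma intT2_mean v : L2 v -> intT2 v = 4 * pi ^+ 2 * mean v.
Proof. by move=> Lv; rewrite meanE fRe00 mulVKf// pi4_neq0. Qed.

Lemma dot_ext f g f' g' : (forall x, sq x -> f x * g x = f' x * g' x) ->
  dot f g = dot f' g'.
Proof. by move=> E; apply: eq_Rintegral => x /set_mem; exact: E. Qed.

(** Two uses of [dot_le_sum_coefs] trade two of the three powers of u for the
    sum of its Fourier coefficients, and the last one for its mean. *)
Lemma int_cubic_le u (c : R * R -> R) q q1 q2 : L2 u -> (forall x, sq x -> 0 < u x) ->
  0 < mean u -> pressure u q -> is_grad q q1 q2 ->
  measurable_fun (sq : set (RR R)) c -> (forall x, `|c x| <= 1) ->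
  L2 (fun x => u x ^+ 2 * c x ^+ 2) ->
  dot u (fun x => u x ^+ 2 * c x ^+ 2) <=
    652 * pi ^+ 2 * mean u ^+ 3 + 113 * mean u * (dot q1 q1 + dot q2 q2).
Proof.
move=> Lu u0 m0 pq gq mc c1 Lg.
have [M [M0 uM MM]] := sum_coefs_le Lu (fun x sx => ltW (u0 x sx)) m0 pq gq.
have c21 x : 0 <= c x ^+ 2 <= 1.
  rewrite sqr_ge0/= -(real_normK (num_real (c x))) -[leRHS](expr1n _ 2).
  by rewrite lerXn2r ?nnegrE.
have mc2 : measurable_fun (sq : set (RR R)) (fun x => c x ^+ 2) by exact: measurable_funX.
have Lc : L2 (fun x => u x * c x ^+ 2).
  apply: (sqint_dominated mS Lu).
    by apply: measurable_funM => //; case: Lu.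
  move=> x sx; have /andP[h1 h2] := c21 x.
  by rewrite normrM [X in _ * X]ger0_norm// ler_piMr.
have s1 := dot_le_sum_coefs Lu Lg _ uM.
have {s1} s1 : dot u (fun x => u x ^+ 2 * c x ^+ 2) <=
    M * intT2 (fun x => u x ^+ 2 * c x ^+ 2).
  by apply: s1 => x sx; rewrite mulr_ge0 ?sqr_ge0.
have e2 : intT2 (fun x => u x ^+ 2 * c x ^+ 2) = dot u (fun x => u x * c x ^+ 2).
  by apply: eq_Rintegral => x _; rewrite expr2 mulrA.
have s2 : dot u (fun x => u x * c x ^+ 2) <= M * intT2 (fun x => u x * c x ^+ 2).
  apply: dot_le_sum_coefs => // x sx; rewrite mulr_ge0 ?sqr_ge0//.
  exact/ltW/u0.
have s3 : intT2 (fun x => u x * c x ^+ 2) <= 4 * pi ^+ 2 * mean u.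
  rewrite -intT2_mean//; apply: intT2_le => // x sx.
  by have /andP[h1 h2] := c21 x; rewrite ler_piMr// ltW// u0.
apply: (le_trans s1); rewrite e2.
apply: (@le_trans _ _ (M ^+ 2 * (4 * pi ^+ 2 * mean u))).
  rewrite expr2 -mulrA ler_wpM2l// (le_trans s2)// ler_wpM2l//.
have p0 : 0 <= 4 * pi ^+ 2 * mean u.
  by rewrite !mulr_ge0 ?exprn_ge0 ?pi_ge0// ltW.
apply: (le_trans (ler_wpM2r p0 MM)); rewrite le_eqVlt; apply/orP; left; apply/eqP.
by have := pi_neq0 R; move: (dot _ _) (dot _ _) (mean u); move: pi => *; field.
Qed.

(** The arithmetic of the energy balance.  Here x1 + x2 bounds the dissipation
    y1 + y2 from below, f is the power of the forcing, and Young's inequality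
    f <= y1 / 4 + k is followed by k <= A + (x1 + x2) / 4. *)
Lemma absorb_force (x1 x2 y1 y2 e A B k f : R) : k <= A + B -> B <= (x1 + x2) / 4 ->
  x1 <= y1 -> x2 <= y2 -> 4 * e <= x1 + x2 -> f <= y1 / 4 + k -> 0 <= x2 ->
  - (y1 + y2) + f <= - (2 * e) + A.
Proof. by move=> *; lra. Qed.

(** Testing the equation with q = Delta u + u.  The forcing is absorbed twice: by
    Young's inequality, and then, for small delta, through [int_cubic_le]. *)
Theorem energy_dissipation (gamma c0 delta t : R) u ut g1 g2 :
  0 < gamma -> 0 < c0 -> 0 < mean u -> 0 < delta ->
  452 * mean u * delta ^+ 2 <= gamma ^+ 2 * c0 ^+ 3 ->
  (forall x, c0 <= u x) -> L2 ut -> is_grad u g1 g2 ->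
  pde gamma delta t u ut ->
  exists2 q, pressure u q &
    - dot q ut <= - (2 * (gamma * c0 ^+ 3) * energy (mean u) u g1 g2)
      + 652 * pi ^+ 2 * mean u ^+ 3 / gamma * delta ^+ 2.
Proof.
move=> ga0 c00 m0 de0 small uc Lut gu.
move=> [lap [q1 [q2 [d [s [lapu gq [a [b [da db dE]]] ds eqn]]]]]].
have [Lu _ _] := L2_grad gu; have pq := pressure_laplacian Lu lapu.
exists (fun x => lap x + u x) => //; set q := fun x => lap x + u x in gq pq *.
have [[/L2T2_L2 Lq /L2T2_L2 Lq1 _] [_ /L2T2_L2 Lq2 _]] := gq.
have [/L2T2_L2 LF1 /L2T2_L2 La _] := da; have [/L2T2_L2 LF2 /L2T2_L2 Lb _] := db.
have [/L2T2_L2 LG /L2T2_L2 Ls _] := ds.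
set F1 := fun x => u x ^+ 3 * q1 x in da LF1 *.
set F2 := fun x => u x ^+ 3 * q2 x in db LF2 *.
set G := fun x => u x ^+ 3 * cos (x.1 + t) in ds LG *.
have u0 x : 0 < u x by exact: lt_le_trans (uc x).
have Ld : L2 d by rewrite dE; exact: sqintD.
have dq : dot q d = - (dot q1 F1 + dot q2 F2).
  have [gq1 gq2] := gq.
  by rewrite dE ipDr// (dot_dtheta gq1 da) (dot_dzeta gq2 db) opprD.
have sq1 : dot q s = - dot q1 G by exact: dot_dtheta gq.1 ds.
have qut : dot q ut = - (gamma * dot q d) + delta * dot q s.
  have Lr : L2 (fun x => - gamma * d x + delta * s x).
    by apply: sqintD => //; exact: sqintZ.
  rewrite ipC (dot_ae Lut Lr)//.
    rewrite ipDl//; try by apply: sqintZ.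
    by rewrite !ipZl// mulNr (ipC mu sq d) (ipC mu sq s).
  move: eqn; apply: (@filterS _ _ (ae_filter_ringOfSetsType mu)) => x h sx.
  by rewrite -(h sx); ring.
pose c (x : R * R) := cos (x.1 + t).
have cE : c = mode 1 0 t.
  by apply/funext => x; rewrite /c /mode mulr1z mul1r mulr0z mul0r addr0.
have Lc : L2 c by rewrite cE; exact: L2_mode.
have c1 x : `|c x| <= 1 by exact: cos_max.
have mobility qi : L2 qi -> L2 (fun x => u x ^+ 3 * qi x) ->
    c0 ^+ 3 * dot qi qi <= dot qi (fun x => u x ^+ 3 * qi x).
  move=> Lqi LFi; rewrite -subr_ge0 -ipZr// -ipBr//; last exact: sqintZ.
  apply: Rintegral_ge0 => x _; rewrite -mulrBl mulrCA -expr2 mulr_ge0 ?sqr_ge0//.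
  by rewrite subr_ge0 lerXn2r ?nnegrE// ltW.
(* Young's inequality with the weight u^3: the integral of
   u^3 (gamma q1 / 2 - delta c)^2 is non-negative *)
have force : delta * dot q1 G <= gamma / 4 * dot q1 F1 + delta ^+ 2 / gamma * dot c G.
  have La1 := sqintZ mS (gamma / 2) Lq1; have La2 := sqintZ mS delta Lc.
  have Lb1 := sqintZ mS (gamma / 2) LF1; have Lb2 := sqintZ mS delta LG.
  have : 0 <= dot (fun x => gamma / 2 * q1 x - delta * c x)
                  (fun x => gamma / 2 * F1 x - delta * G x).
    apply: Rintegral_ge0 => x _.
    have -> : gamma / 2 * F1 x - delta * G x =
       u x ^+ 3 * (gamma / 2 * q1 x - delta * c x) by rewrite /F1 /G /c; ring.
    by rewrite mulrCA -expr2 mulr_ge0 ?sqr_ge0// exprn_ge0// ltW.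
  have Lab := sqintB mS Lb1 Lb2.
  rewrite ipBl// !ipBr// !ipZl// !ipZr//.
  have -> : dot c F1 = dot q1 G by apply: dot_ext => x _; rewrite /F1 /G /c; ring.
  set A := dot q1 F1; set B := dot q1 G; set Y := dot c G => h.
  rewrite -subr_ge0.
  have -> : gamma / 4 * A + delta ^+ 2 / gamma * Y - delta * B =
   (gamma / 2 * (gamma / 2 * A) - gamma / 2 * (delta * B)
    - (delta * (gamma / 2 * B) - delta * (delta * Y))) / gamma.
    by field; rewrite gt_eqF.
  by rewrite divr_ge0// ltW.
have Lg : L2 (fun x => u x ^+ 2 * c x ^+ 2).
  apply: (sqint_dominated mS (sqintZ mS c0^-1 LG)).
    by apply: measurable_funM; apply: measurable_funX; [case: Lu|case: Lc].
  move=> x _; rewrite normrM ger0_norm ?sqr_ge0// [X in _ * X]ger0_norm ?sqr_ge0//.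
  rewrite /G normrM ger0_norm ?invr_ge0 ?(ltW c00)// normrM.
  rewrite [`|u x ^+ 3|]ger0_norm ?exprn_ge0 ?(ltW (u0 x))// -/(c x).
  rewrite ler_pdivlMl// exprS mulrA.
  have c2 : c x ^+ 2 <= `|c x|.
    by rewrite -(real_normK (num_real (c x))) expr2 ler_piMr.
  apply: (@le_trans _ _ (c0 * (u x ^+ 2 * `|c x|))).
    by rewrite -mulrA ler_wpM2l ?(ltW c00)// ler_wpM2l ?sqr_ge0.
  by rewrite -[leRHS]mulrA ler_wpM2r// mulr_ge0 ?sqr_ge0.
have cub := int_cubic_le Lu (fun x _ => u0 x) m0 pq gq (Lc.1) c1 Lg.
have eY : dot c G = dot u (fun x => u x ^+ 2 * c x ^+ 2).
  by apply: dot_ext => x _; rewrite /G -/(c x); ring.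
have co := coercive gu pq gq.
have m1 := mobility _ Lq1 LF1; have m2 := mobility _ Lq2 LF2.
rewrite -eY in cub; rewrite qut sq1 dq.
move: (energy _ _ _ _) co => En co.
move: (dot q1 F1) (dot q2 F2) (dot q1 G) (dot c G) m1 m2 force cub => I1 I2 B Y.
rewrite -/F1 -/F2.
have := ip_ge0 mu sq q1; have := ip_ge0 mu sq q2.
move: (dot q1 q1) (dot q2 q2) co => D1 D2 co D20 D10 m1 m2 force cub.
have dg : 0 <= delta ^+ 2 / gamma by rewrite divr_ge0 ?sqr_ge0// ltW.
have s1 := ler_wpM2l dg cub.
have s2 : delta ^+ 2 / gamma * (113 * mean u * (D1 + D2)) <=
    gamma / 4 * c0 ^+ 3 * (D1 + D2).
  rewrite mulrA ler_wpM2r ?addr_ge0// mulrAC ler_pdivrMr//.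
  have -> : gamma / 4 * c0 ^+ 3 * gamma = gamma ^+ 2 * c0 ^+ 3 / 4 by ring.
  by rewrite ler_pdivlMr// (le_trans _ small)// le_eqVlt; apply/orP; left; apply/eqP; ring.
have s3 : gamma * (c0 ^+ 3 * D1) <= gamma * I1 by rewrite ler_wpM2l// ltW.
have s4 : gamma * (c0 ^+ 3 * D2) <= gamma * I2 by rewrite ler_wpM2l// ltW.
have cg : 0 <= gamma * c0 ^+ 3 by rewrite mulr_ge0 ?exprn_ge0// ltW.
have s5 := ler_wpM2l cg co.
have -> : - (- (gamma * - (I1 + I2)) + delta * - B) =
  - (gamma * I1 + gamma * I2) + delta * B by ring.
have -> : - (2 * (gamma * c0 ^+ 3) * En)
    + 652 * pi ^+ 2 * mean u ^+ 3 / gamma * delta ^+ 2 =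
  - (2 * (gamma * c0 ^+ 3 * En))
    + delta ^+ 2 / gamma * (652 * pi ^+ 2 * mean u ^+ 3) by ring.
rewrite mulrDr in s1.
apply: (absorb_force s1 _ s3 s4).
- by rewrite (le_trans s2)// le_eqVlt; apply/orP; left; apply/eqP; ring.
- by move: s5; congr (_ <= _); ring.
- by rewrite (le_trans force)// le_eqVlt; apply/orP; left; apply/eqP; ring.
- by rewrite mulr_ge0 ?(ltW ga0)// mulr_ge0 ?exprn_ge0// ltW.
Qed.

End Dissipation.

(** * Evolution in time *)

Section RealTime.
Variable R : realType.
Implicit Types (f : R -> R) (t T : R).

Lemma is_derive_quotient f t l :
  (f s - f t) / (s - t) @[s --> t^'] --> l -> is_derive t (1 : R) f l.
Proof.
move=> c.
have sh : h + t @[h --> (0 : R)^'] --> t^'.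
  move=> P; rewrite /= /dnbhs /within/= => Pt.
  have : h + t @[h --> (0 : R)] --> t.
    by rewrite -[X in _ --> X]add0r; apply: cvgD; [exact: cvg_id|exact: cvg_cst].
  move=> /(_ _ Pt) Q; rewrite /=.
  have : nbhs (0 : R) [set h | h + t != t -> P (h + t)] by exact: Q.
  apply: filterS => h /= Ph h0; apply: Ph.
  by apply/eqP => /(canRL (addrK t)) h1; move: h0; rewrite h1 subrr eqxx.
have c2 := cvg_comp _ _ sh c.
have c3 : h^-1 *: ((f \o shift t) (h *: (1 : R)) - f t) @[h --> (0 : R)^'] --> l.
  move: c2; apply: cvg_trans; apply: near_eq_cvg.
  by apply: nearW => h /=; rewrite addrK mulrC /GRing.scale/= mulr1.
apply: DeriveDef; first by apply/cvg_ex; exists l.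
by apply: cvg_lim => //; exact: Rhausdorff.
Qed.

Lemma dnbhs_within_itv t T (b : bool) : 0 < t < T ->
  t^' --> within [set` Interval (BSide b 0) (BRight T)] (dnbhs t).
Proof.
move=> /andP[t0 tT] P h.
have h1 : \forall s \near t^', s \in Interval (BSide b 0) (BRight T) -> P s by exact: h.
have h2 : \forall s \near t^', s \in `]0, T[.
  by apply: nbhs_dnbhs; apply: near_in_itvoo; rewrite in_itv/= t0.
suff : \forall s \near t^', P s by [].
near=> s; have hs : s \in Interval (BSide b 0) (BRight T) -> P s by near: s.
have : s \in `]0, T[ by near: s.
rewrite in_itv/= => /andP[s0 sT]; apply: hs.
by rewrite in_itv/= (ltW sT) andbT; move: (b) => []; rewrite /= ?(ltW s0).
Unshelve. all: by end_near. Qed.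

Lemma dnbhs_within_cc t T : 0 < t < T ->
  t^' --> within `[0, T]%classic (nbhs t).
Proof.
move=> tT P h; have D := @dnbhs_within_itv _ _ true tT; apply: (D P).
have h1 : nbhs t [set s | `[0, T]%classic s -> P s] by exact: h.
exact: (nbhs_dnbhs h1).
Qed.

(** Gronwall's inequality: multiply by the integrating factor. *)
Lemma gronwall f df (a b T : R) : 0 < a ->
  {within `[0, T], continuous f} ->
  (forall t, 0 < t < T -> is_derive t (1 : R) f (df t)) ->
  (forall t, 0 < t < T -> df t <= - (a * f t) + b) ->
  0 <= b -> forall t, 0 <= t <= T -> f t <= f 0 * expR (- (a * t)) + b / a.
Proof.
move=> a0 cf fd dle b0 t /andP[t0 tT].
pose F s := (f s - b / a) * expR (a * s).
have dE (s : R) : is_derive s (1 : R) (fun s => expR (a * s)) (a * expR (a * s)).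
  apply: is_derive_eq; rewrite /GRing.scale/=; ring.
have dF s : 0 < s < T -> is_derive s (1 : R) F
    (df s * expR (a * s) + (f s - b / a) * (a * expR (a * s))).
  move=> sT; have fs := fd s sT; have es := dE s.
  rewrite /F; apply: is_derive_eq; rewrite /GRing.scale/=; ring.
have cF : {within `[0, T], continuous F}.
  move=> x; apply: cvgM.
    by apply: cvgB; [exact: cf|exact: cvg_cst].
  apply: continuous_subspaceT => y.
  apply/differentiable_continuous/derivable1_diffP.
  exact: (@ex_derive _ _ _ _ _ _ _ (dE y)).
have Fle : F t <= F 0.
  apply: (ler0_derive1_nincr (a := 0) (b := T)) => //.
  - by move=> x; rewrite in_itv/= => xT; have := dF x xT; case.
  - move=> x; rewrite in_itv/= => xT; rewrite derive1E.
    have [_ ->] := dF x xT.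
    have -> : df x * expR (a * x) + (f x - b / a) * (a * expR (a * x)) =
      (df x - (- (a * f x) + b)) * expR (a * x).
      by field; rewrite gt_eqF.
    by rewrite mulr_le0_ge0 ?expR_ge0// subr_le0; exact: dle.
move: Fle; rewrite /F mulr0 expR0 mulr1 => h.
have E1 : expR (a * t) * expR (- (a * t)) = 1 by rewrite -expRD subrr expR0.
have := ler_wpM2r (expR_ge0 (- (a * t))) h; rewrite -mulrA E1 mulr1.
rewrite mulrBl => h2.
have : 0 <= b / a * expR (- (a * t)) by rewrite mulr_ge0 ?expR_ge0// divr_ge0// ltW.
by lra.
Qed.

End RealTime.

Section L2Limits.
Variable R : realType.

Lemma cvg_dot_cst (F : set_system R) (FF : Filter F) (w : R * R -> R) :
  dot (fun x => w x - w x) (fun x => w x - w x) @[_ --> F] --> 0.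
Proof.
have -> : dot (fun x => w x - w x) (fun x => w x - w x) = 0.
  by rewrite /ip /Rintegral integral0_eq// => x _; rewrite subrr mulr0.
exact: cvg_cst.
Qed.

Lemma cvg_dot_L2sqnorm (F : set_system R) (FF : Filter F) (w : R -> R * R -> R) :
  (\forall s \near F, L2 (w s)) -> L2sqnorm (w s) @[s --> F] --> 0%E ->
  dot (w s) (w s) @[s --> F] --> 0.
Proof.
move=> Lw /fine_cvgP[_]; apply: cvg_trans; apply: near_eq_cvg.
by move: Lw; apply: filterS => s Ls; rewrite /= L2sqnorm_dot.
Qed.

Lemma cvg_dot_Hsqnorm (F : set_system R) (FF : Filter F) (alpha : R)
    (V w : R -> R * R -> R) : (\forall s \near F, L2 (w s)) ->
  (\forall s \near F, forall p, fsqr (w s) p <= (1 + lam R p) `^ alpha * fsqr (V s) p) ->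
  Hsqnorm alpha (V s) @[s --> F] --> 0%E ->
  dot (w s) (w s) @[s --> F] --> 0.
Proof.
move=> Lw wV /fine_cvgP[fin cV].
have c : 4 * pi ^+ 2 * fine (Hsqnorm alpha (V s)) @[s --> F] --> 0.
  by rewrite -(mulr0 (4 * pi ^+ 2)); apply: cvgM => //; exact: cvg_cst.
apply: (squeeze_cvgr (f := fun=> 0) (h := fun s => 4 * pi ^+ 2 * fine (Hsqnorm alpha (V s)))).
- near=> s; rewrite ip_ge0/=; apply: dot_le_Hsqnorm.
  + by near: s.
  + by rewrite -ge0_fin_numE ?Hsqnorm_ge0//; near: s.
  + by near: s.
- exact: cvg_cst.
- exact: c.
Unshelve. all: by end_near. Qed.

End L2Limits.

Section Solution.
Variable R : realType.

Implicit Types s t m : R.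

(** Only the regularity of solutions is assumed here; the equation enters through
    the values of [Ht], in [mean_conserved] and in [is_derive_energy]. *)
Variables (T alpha : R) (H Ht : R -> R * R -> R).
Hypothesis alpha3 : 3 < alpha.
Hypothesis H_L2 : forall t : R, 0 <= t <= T -> L2 (H t).
Hypothesis H_cont : forall t : R, 0 <= t <= T ->
  Hsqnorm alpha (fun x => H s x - H t x) @[s --> within `[0, T]%classic (nbhs t)] --> 0%E.
Hypothesis Ht_L2 : forall t : R, 0 < t <= T -> L2 (Ht t).
Hypothesis H_diff : forall t : R, 0 < t <= T ->
  L2sqnorm (fun x => (H s x - H t x) / (s - t) - Ht t x)
    @[s --> within `]0, T]%classic (dnbhs t)] --> 0%E.

Lemma near_within_cc t (P : R -> Prop) : (forall s : R, 0 <= s <= T -> P s) ->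
  \forall s \near within `[0, T]%classic (nbhs t), P s.
Proof.
move=> h; have : \forall s \near nbhs t, s \in `[0, T] -> P s.
  by apply: nearW => s; rewrite in_itv; exact: h.
exact.
Qed.

Lemma near_dnbhs_oo t (P : R -> Prop) : 0 < t < T ->
  (forall s : R, 0 < s < T -> P s) -> \forall s \near t^', P s.
Proof.
move=> tT h; have tI : t \in `]0, T[ by rewrite in_itv.
have h2 := nbhs_dnbhs (near_in_itvoo tI).
near=> s; have : s \in `]0, T[ by near: s.
by rewrite in_itv; exact: h.
Unshelve. all: by end_near. Qed.

(** A function controlled mode by mode by the H^2 part of H inherits from H the
    continuity in time, with values in L_2. *)
Lemma cvg_dot_weighted t (w : R -> R * R -> R) : 0 <= t <= T ->
  (forall s : R, 0 <= s <= T -> L2 (w s)) ->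
  (forall (s : R) p, 0 <= s <= T ->
    fsqr (w s) p <= (1 + lam R p) ^+ 2 * fsqr (fun x => H s x - H t x) p) ->
  dot (w s) (w s) @[s --> within `[0, T]%classic (nbhs t)] --> 0.
Proof.
move=> tT Lw wH; apply: (@cvg_dot_Hsqnorm _ _ _ alpha (fun s x => H s x - H t x) w).
- exact: near_within_cc.
- apply: near_within_cc => s sT p; apply: (le_trans (wH s p sT)); rewrite ler_wpM2r ?fsqr_ge0//.
  by apply: powR_ge_sqr; [have := alpha3; lra|rewrite lerDl lam_ge0].
- exact: H_cont.
Qed.

Lemma cvg_H t : 0 <= t <= T ->
  dot (fun x => H s x - H t x) (fun x => H s x - H t x)
    @[s --> within `[0, T]%classic (nbhs t)] --> 0.
Proof.
move=> tT; apply: (cvg_dot_weighted (w := fun s x => H s x - H t x) tT).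
  by move=> s sT; apply: sqintB => //; exact: H_L2.
by move=> s p sT; rewrite ler_peMl ?fsqr_ge0// exprn_ege1// lerDl lam_ge0.
Qed.

Lemma cvg_grad t (g1 g2 : R -> R * R -> R) : 0 <= t <= T ->
  (forall s : R, 0 <= s <= T -> is_grad (H s) (g1 s) (g2 s)) ->
  dot (fun x => g1 s x - g1 t x) (fun x => g1 s x - g1 t x)
    @[s --> within `[0, T]%classic (nbhs t)] --> 0 /\
  dot (fun x => g2 s x - g2 t x) (fun x => g2 s x - g2 t x)
    @[s --> within `[0, T]%classic (nbhs t)] --> 0.
Proof.
move=> tT gH.
have le1 p : p.1%:~R ^+ 2 <= (1 + lam R p) ^+ 2 /\ p.2%:~R ^+ 2 <= (1 + lam R p) ^+ 2.
  rewrite /lam; have := sqr_ge0 (p.1%:~R : R); have := sqr_ge0 (p.2%:~R : R).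
  by move: (_ ^+ 2) (_ ^+ 2) => x y x0 y0; split; nra.
have Ld1 s : 0 <= s <= T -> L2 (fun x => g1 s x - g1 t x).
  by move=> sT; have [_ h _] := L2_grad (gH s sT); have [_ k _] := L2_grad (gH t tT); exact: sqintB.
have Ld2 s : 0 <= s <= T -> L2 (fun x => g2 s x - g2 t x).
  by move=> sT; have [_ _ h] := L2_grad (gH s sT); have [_ _ k] := L2_grad (gH t tT); exact: sqintB.
split.
- apply: (cvg_dot_weighted (w := fun s x => g1 s x - g1 t x) tT) => // s p sT.
  have [Ls Ls1 _] := L2_grad (gH s sT); have [Lt Lt1 _] := L2_grad (gH t tT).
  have [ds _] := gH s sT; have [dt _] := gH t tT.
  have -> : fsqr (fun x => g1 s x - g1 t x) p =
     p.1%:~R ^+ 2 * fsqr (fun x => H s x - H t x) p.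
    rewrite /fsqr !fReB// !fImB// !(fRe_dtheta _ ds, fIm_dtheta _ ds).
    by rewrite !(fRe_dtheta _ dt, fIm_dtheta _ dt); ring.
  by rewrite ler_wpM2r ?fsqr_ge0//; case: (le1 p).
- apply: (cvg_dot_weighted (w := fun s x => g2 s x - g2 t x) tT) => // s p sT.
  have [Ls _ Ls1] := L2_grad (gH s sT); have [Lt _ Lt1] := L2_grad (gH t tT).
  have [_ ds] := gH s sT; have [_ dt] := gH t tT.
  have -> : fsqr (fun x => g2 s x - g2 t x) p =
     p.2%:~R ^+ 2 * fsqr (fun x => H s x - H t x) p.
    rewrite /fsqr !fReB// !fImB// !(fRe_dzeta _ ds, fIm_dzeta _ ds).
    by rewrite !(fRe_dzeta _ dt, fIm_dzeta _ dt); ring.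
  by rewrite ler_wpM2r ?fsqr_ge0//; case: (le1 p).
Qed.

Lemma within_continuous_dot (u v : R -> R * R -> R) :
  (forall t : R, 0 <= t <= T -> L2 (u t)) -> (forall t : R, 0 <= t <= T -> L2 (v t)) ->
  (forall t : R, 0 <= t <= T -> dot (fun x => u s x - u t x) (fun x => u s x - u t x)
    @[s --> within `[0, T]%classic (nbhs t)] --> 0) ->
  (forall t : R, 0 <= t <= T -> dot (fun x => v s x - v t x) (fun x => v s x - v t x)
    @[s --> within `[0, T]%classic (nbhs t)] --> 0) ->
  {within `[0, T], continuous (fun t => dot (u t) (v t))}.
Proof.
move=> Lu Lv cu cv; apply/subspace_continuousP => t; rewrite /= in_itv/= => tT.
apply: (cvg_ip mS) => //; try exact: Lu; try exact: Lv; try exact: cu; try exact: cv.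
- exact: near_within_cc.
- exact: near_within_cc.
Qed.

Lemma within_continuous_energy m (g1 g2 : R -> R * R -> R) :
  (forall s : R, 0 <= s <= T -> is_grad (H s) (g1 s) (g2 s)) ->
  {within `[0, T], continuous (fun t => energy m (H t) (g1 t) (g2 t))}.
Proof.
move=> gH.
have L1 t : 0 <= t <= T -> L2 (g1 t) by move=> tT; case: (L2_grad (gH t tT)).
have L2' t : 0 <= t <= T -> L2 (g2 t) by move=> tT; case: (L2_grad (gH t tT)).
have c1 := within_continuous_dot L1 L1 (fun t tT => (cvg_grad tT gH).1)
  (fun t tT => (cvg_grad tT gH).1).
have c2 := within_continuous_dot L2' L2' (fun t tT => (cvg_grad tT gH).2)
  (fun t tT => (cvg_grad tT gH).2).
have c3 := within_continuous_dot H_L2 H_L2 cvg_H cvg_H.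
move=> t; rewrite /energy; apply: cvgD; last exact: cvg_cst.
apply: cvgM; first exact: cvg_cst.
by apply: cvgB; [apply: cvgD; [exact: c1|exact: c2]|exact: c3].
Qed.

Definition quotient t s (x : R * R) : R := (s - t)^-1 * (H s x - H t x).

Lemma L2_quotient t s : 0 <= t <= T -> 0 <= s <= T -> L2 (quotient t s).
Proof. by move=> tT sT; apply: sqintZ => //; apply: sqintB => //; exact: H_L2. Qed.

Lemma cvg_quotient t : 0 < t < T ->
  dot (fun x => quotient t s x - Ht t x) (fun x => quotient t s x - Ht t x)
    @[s --> t^'] --> 0.
Proof.
move=> tT; have tT' : 0 < t <= T by case/andP: tT => -> /ltW.
have tT2 : 0 <= t <= T by case/andP: tT => /ltW-> /ltW.
apply: (@cvg_dot_L2sqnorm _ _ _ (fun s x => quotient t s x - Ht t x)).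
  apply: (near_dnbhs_oo tT) => s /andP[/ltW s0 /ltW sT].
  by apply: sqintB => //; [apply: L2_quotient; rewrite ?s0|exact: Ht_L2].
have := H_diff tT'.
rewrite (_ : (fun s => _) = (fun s => L2sqnorm (fun x => quotient t s x - Ht t x))).
  by move=> c; apply: cvg_trans c; apply: cvg_app; exact: (@dnbhs_within_itv _ _ _ false tT).
apply/funext => s; congr L2sqnorm; apply/funext => x.
by rewrite /quotient mulrC.
Qed.

(** E(s) - E(t) = - (q(s) + q(t), H(s) - H(t)) / 2 by the symmetry of the
    operator Delta + 1, so that E' = - (q, H_t). *)
Lemma is_derive_energy m (g1 g2 q : R -> R * R -> R) t :
  (forall s : R, 0 <= s <= T -> is_grad (H s) (g1 s) (g2 s)) ->
  (forall s : R, 0 <= s <= T -> mean (H s) = m) ->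
  (forall s : R, 0 < s <= T -> pressure (H s) (q s)) -> 0 < t < T ->
  is_derive t (1 : R) (fun t => energy m (H t) (g1 t) (g2 t)) (- dot (q t) (Ht t)).
Proof.
move=> gH mH qH tT; have tT' : 0 < t <= T by case/andP: tT => -> /ltW.
have tT2 : 0 <= t <= T by case/andP: tT => /ltW-> /ltW.
have Fd : Filter t^' by exact: _.
have [_ Lqt hqt] := qH t tT'.
have EE s : 0 < s <= T -> energy m (H s) (g1 s) (g2 s) =
    - (2^-1 * dot (q s) (H s)) + 2 * pi ^+ 2 * m ^+ 2.
  move=> sT; have sT2 : 0 <= s <= T by case/andP: sT => /ltW-> ->.
  by rewrite -(mH s sT2); apply: energy_pressure; [exact: gH|exact: qH].
have c : - (2^-1 * dot (fun x => q s x + q t x) (quotient t s)) @[s --> t^'] -->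
    - (2^-1 * dot (fun x => q t x + q t x) (Ht t)).
  apply: cvgN; apply: cvgM; first exact: cvg_cst.
  apply: (cvg_ip mS) => //.
  - apply: (near_dnbhs_oo tT) => s /andP[s0 /ltW sT]; apply: sqintD => //.
    by case: (qH s); rewrite ?s0.
  - apply: (near_dnbhs_oo tT) => s /andP[/ltW s0 /ltW sT].
    by apply: L2_quotient; rewrite ?s0.
  - exact: sqintD.
  - exact: Ht_L2.
  - rewrite (_ : (fun s => _) =
      (fun s => dot (fun x => q s x - q t x) (fun x => q s x - q t x))); last first.
      by apply/funext => s; congr ip; apply/funext => x; ring.
    apply: (@cvg_dot_Hsqnorm _ _ _ alpha (fun s x => H s x - H t x)
      (fun s x => q s x - q t x)).
    + apply: (near_dnbhs_oo tT) => s /andP[s0 /ltW sT]; apply: sqintB => //.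
      by case: (qH s); rewrite ?s0.
    + apply: (near_dnbhs_oo tT) => s /andP[s0 /ltW sT] p.
      have sT' : 0 < s <= T by rewrite s0.
      have [_ _ h] := pressureB (qH s sT') (qH t tT').
      have -> : fsqr (fun x => q s x - q t x) p =
          (1 - lam R p) ^+ 2 * fsqr (fun x => H s x - H t x) p.
        by rewrite /fsqr (h p).1 (h p).2; ring.
      rewrite ler_wpM2r ?fsqr_ge0//.
      have l0 := lam_ge0 R p.
      apply: (@le_trans _ _ ((1 + lam R p) ^+ 2)); first nra.
      by apply: powR_ge_sqr; [have := alpha3; lra|rewrite lerDl].
    + have := H_cont tT2; apply: cvg_trans; apply: cvg_app.
      exact: (@dnbhs_within_cc _ _ _ tT).
  - exact: cvg_quotient.
have -> : - dot (q t) (Ht t) = - (2^-1 * dot (fun x => q t x + q t x) (Ht t)).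
  by have LH := Ht_L2 tT'; rewrite ipDl//; field.
apply: is_derive_quotient; move: c; apply: cvg_trans; apply: near_eq_cvg.
near=> s; have sT : 0 < s <= T.
  by near: s; apply: (near_dnbhs_oo tT) => s /andP[-> /ltW->].
have st : s != t by near: s; exact: nbhs_dnbhs_neq.
have [Ls Lqs _] := qH s sT; have [Lt _ _] := qH t tT'.
rewrite !EE// /quotient ipZr//; try (by apply: sqintD); try (by apply: sqintB).
rewrite ipDl//; last by apply: sqintB.
rewrite !ipBr// (dot_pressure (qH t tT') (qH s sT)) (ipC mu sq (H t)).
by field; rewrite subr_eq0.
Unshelve. all: by end_near. Qed.

Lemma mean_conserved m : 0 < T -> mean (H 0) = m ->
  (forall t : R, 0 < t <= T -> mean (Ht t) = 0) ->
  forall t : R, 0 <= t <= T -> mean (H t) = m.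
Proof.
move=> T0 m0 mHt.
have cm : {within `[0, T], continuous (fun t => mean (H t))}.
  have c := within_continuous_dot (u := H) (v := fun=> mode 0 0 0) H_L2
    (fun t _ => L2_mode 0 0 0) cvg_H.
  have {c} c : {within `[0, T], continuous (fun t => dot (H t) (mode 0 0 0))}.
    by apply: c => t _; exact: cvg_dot_cst.
  rewrite (_ : (fun t => _) = (fun t => (4 * pi ^+ 2)^-1 * dot (H t) (mode 0 0 0))).
    by move=> t; apply: cvgM; [exact: cvg_cst|exact: c].
  by apply/funext => t; rewrite meanE.
have dm t : 0 < t < T -> is_derive t (1 : R) (fun t => mean (H t)) 0.
  move=> tT; have tT' : 0 < t <= T by case/andP: tT => -> /ltW.
  have tT2 : 0 <= t <= T by case/andP: tT => /ltW-> /ltW.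
  apply: is_derive_quotient.
  have c : (4 * pi ^+ 2)^-1 * dot (quotient t s) (mode 0 0 0) @[s --> t^'] -->
      (4 * pi ^+ 2)^-1 * dot (Ht t) (mode 0 0 0).
    apply: cvgM; first exact: cvg_cst.
    apply: (cvg_ip mS).
    - apply: (near_dnbhs_oo tT) => s /andP[/ltW s0 /ltW sT].
      by apply: L2_quotient; rewrite ?s0.
    - by apply: nearW => s; exact: L2_mode.
    - exact: Ht_L2.
    - exact: L2_mode.
    - exact: cvg_quotient.
    - exact: cvg_dot_cst.
  have E := mHt t tT'; rewrite meanE /fRe /= in E; rewrite E in c.
  move: c; apply: cvg_trans; apply: near_eq_cvg; near=> s.
  have sT : 0 <= s <= T.
    by near: s; apply: (near_dnbhs_oo tT) => s /andP[/ltW-> /ltW->].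
  rewrite !meanE /fRe /quotient /= ipZl ?ipBl//; try exact: L2_mode; try exact: H_L2;
    try exact: (sqintB mS (H_L2 sT) (H_L2 tT2)); try exact: measurable_square.
  by ring.
move=> t /andP[t0 tT]; move: t0; rewrite le_eqVlt => /predU1P[<-//|t0].
have [||c _ h] := @MVT R (fun t => mean (H t)) (fun=> 0) 0 t t0.
- move=> x; rewrite in_itv/= => /andP[x0 xt]; apply: dm.
  by rewrite x0 (lt_le_trans xt).
- apply: continuous_subspaceW cm => x /=; rewrite !in_itv/= => /andP[-> xt].
  exact: le_trans tT.
by apply/eqP; rewrite -subr_eq0 -m0 h mul0r.
Unshelve. all: by end_near. Qed.

End Solution.

(** Both terms of the equation are derivatives, whose coefficient at the frequency
    (0, 0) is zero. *)
Lemma mean_pde (R : realType) (gamma delta t : R) (u ut : R * R -> R) :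
  L2ev ut -> pde gamma delta t u ut -> mean ut = 0.
Proof.
move=> [/L2T2_L2 Lut _] [lap [q1 [q2 [d [s [_ _ [a [b [da db dE]]] ds eqn]]]]]].
have [_ /L2T2_L2 La _] := da; have [_ /L2T2_L2 Lb _] := db.
have [_ /L2T2_L2 Ls _] := ds.
have mS := @measurable_square R.
have Ld : L2 d by rewrite dE; exact: sqintD.
have Lr : L2 (fun x => - gamma * d x + delta * s x) by apply: sqintD => //; exact: sqintZ.
rewrite meanE; transitivity (fRe (fun x => - gamma * d x + delta * s x) (0, 0)).
  rewrite /fRe; congr (_ * _); apply: dot_ae => //; first exact: L2_mode.
  move: eqn; apply: (@filterS _ _ (ae_filter_ringOfSetsType (@mu2 R))) => x h sx.
  by rewrite -(h sx); ring.
rewrite fReD ?fReZ//; try exact: sqintZ.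
rewrite dE fReD// (fRe_dtheta _ da) (fRe_dzeta _ db) (fRe_dtheta _ ds) /= !mulr0z.
by ring.
Qed.

Lemma forcing_constant (R : realType) (gamma a m delta c : R) :
  gamma != 0 -> a != 0 -> c != 0 ->
  489 * m ^+ 3 / (gamma * a) * delta ^+ 2 = 3 * ((2 * c ^+ 2)^-1 *
    (652 * c ^+ 2 * m ^+ 3 / gamma * delta ^+ 2 / (2 * a))).
Proof. by move=> g0 a0 c0; field; rewrite g0 a0 c0. Qed.

Theorem theorem6p3 (R : realType) (gamma c0 m e0 : R) :
  0 < gamma -> 0 < c0 -> 0 < m -> 0 < e0 ->
  exists delta0 C : R, [/\ 0 < delta0, 0 < C &
    forall (delta T : R) (H : R -> R * R -> R) (h0 : R * R -> R),
      0 < delta < delta0 -> 0 < T ->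
      is_solution gamma delta T H ->
      H 0 = h0 -> mean h0 = m -> has_energy h0 e0 ->
      (forall (t : R) (x : R * R), 0 <= t <= T -> c0 <= H t x) ->
      forall t : R, 0 <= t <= T ->
        distH1_steady m (H t)
          <= 2 * pi * Num.sqrt 3 * distH1_steady m h0
               * expR (- (gamma * c0 ^+ 3 * t))
             + C * delta].
Proof.
move=> ga0 c00 m0 _.
pose a := gamma * c0 ^+ 3.
have a0 : 0 < a by rewrite mulr_gt0// exprn_gt0.
(* the smallness condition of [energy_dissipation] *)
pose delta0 := Num.sqrt (gamma ^+ 2 * c0 ^+ 3 / (452 * m)).
have m452 : 0 < 452 * m by apply: mulr_gt0; rewrite ?ltr0n.
have m489 : 0 < 489 * m ^+ 3 by apply: mulr_gt0; rewrite ?ltr0n ?exprn_gt0.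
have d00 : 0 < gamma ^+ 2 * c0 ^+ 3 / (452 * m).
  exact: divr_gt0 (mulr_gt0 (exprn_gt0 2 ga0) (exprn_gt0 3 c00)) m452.
pose C := Num.sqrt (489 * m ^+ 3 / (gamma * a)).
have C0 : 0 < 489 * m ^+ 3 / (gamma * a) by exact: divr_gt0 m489 (mulr_gt0 ga0 a0).
exists delta0, C; split; [by rewrite sqrtr_gt0|by rewrite sqrtr_gt0|].
move=> delta T H h0 /andP[de0 deltad] T0 sol H0 mh0 en Hc0 t tT.
have [_ [alpha [/andP[al3 _] Hal Hcont]] _ [Ht [HtL Hdiff _ Hpde]]] := sol.
have small : 452 * m * delta ^+ 2 <= gamma ^+ 2 * c0 ^+ 3.
  rewrite mulrC -(ler_pdivlMr _ _ m452) -[leRHS](sqr_sqrtr (ltW d00)).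
  by rewrite lerXn2r ?nnegrE ?sqrtr_ge0 ?(ltW de0)// ltW.
have H_ev s : 0 <= s <= T -> L2ev (H s) by move=> /Hal[].
have H_L2 s : 0 <= s <= T -> L2 (H s) by move=> /H_ev[/L2T2_L2].
have Ht_L2 s : 0 < s <= T -> L2 (Ht s) by move=> /HtL[/L2T2_L2].
have Hm : forall s, 0 <= s <= T -> mean (H s) = m.
  apply: (mean_conserved al3 H_L2 Hcont Ht_L2 Hdiff T0); first by rewrite H0.
  by move=> s sT; apply: (mean_pde (HtL s sT) (Hpde s sT)).
(* at positive times the gradient comes with the Laplacian, at time 0 with the
   energy *)
have /choice[g1 /choice[g2 gH]] : forall s, exists g1 : R * R -> R,
    exists g2 : R * R -> R, 0 <= s <= T -> is_grad (H s) g1 g2.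
  move=> s; have [/andP[s0 sT]|] := boolP (0 <= s <= T); last first.
    by exists (H 0), (H 0).
  move: s0; rewrite le_eqVlt => /predU1P[<-|s0].
    by have [g1 [g2 [gg _]]] := en; exists g1, g2; rewrite H0.
  have [|lap [_ [_ [_ [_ [[g1 [g2 [gg _]]] _ _ _ _]]]]]] := Hpde s; first by rewrite s0.
  by exists g1, g2.
have [K KE K0] : exists2 K, K = 652 * pi ^+ 2 * m ^+ 3 / gamma * delta ^+ 2 & 0 <= K.
  have p652 : 0 <= 652 * pi ^+ 2 :> R by apply: mulr_ge0; [rewrite ler0n|exact: sqr_ge0].
  eexists; first by [].
  apply: mulr_ge0 (sqr_ge0 _); apply: divr_ge0 (ltW ga0).
  exact: mulr_ge0 p652 (exprn_ge0 3 (ltW m0)).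
have /choice[q qH] : forall s, exists q : R * R -> R, 0 < s <= T ->
    pressure (H s) q /\ - dot q (Ht s) <=
      - (2 * a * energy m (H s) (g1 s) (g2 s)) + K.
  move=> s; have [sT|] := boolP (0 < s <= T); last by exists (H 0).
  have sT2 : 0 <= s <= T by case/andP: sT => /ltW -> ->.
  have := @energy_dissipation R gamma c0 delta s (H s) (Ht s) (g1 s) (g2 s) ga0 c00.
  rewrite (Hm s sT2) => /(_ m0 de0 small (fun x => Hc0 s x sT2) (Ht_L2 s sT) (gH s sT2)
    (Hpde s sT))[q pq qle].
  by exists q; rewrite KE.
have decay := @gronwall R (fun s => energy m (H s) (g1 s) (g2 s))
  (fun s => - dot (q s) (Ht s)) (2 * a) K T.
have {decay} decay : energy m (H t) (g1 t) (g2 t) <=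
    energy m (H 0) (g1 0) (g2 0) * expR (- (2 * a * t))
    + K / (2 * a).
  apply: decay => //.
  - by rewrite mulr_gt0.
  - exact: (within_continuous_energy al3 H_L2 Hcont).
  - move=> s sT; apply: (is_derive_energy al3 H_L2 Hcont Ht_L2 Hdiff gH Hm) => //.
    by move=> r rT; case: (qH r rT).
  - move=> s /andP[s0 sT]; have sT2 : 0 < s <= T by rewrite s0 ltW.
    by case: (qH s sT2).
have T00 : 0 <= (0 : R) <= T by rewrite lexx ltW.
have up := distH1_sqr_le (H_ev t tT) (gH t tT).
have [_ finH] := Hal 0 T00.
have al1 : 1 <= alpha by apply: ltW; apply: lt_trans al3; rewrite ltr1n.
have low := energy_le_distH1 (H_ev 0 T00) (gH 0 T00) al1 finH.
rewrite (Hm t tT) in up; rewrite (Hm 0 T00) H0 in low; rewrite H0 in decay.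
set D := distH1_steady m (H t) in up *; set D0 := distH1_steady m h0 in low *.
have D00 : 0 <= D0 by exact: sqrtr_ge0.
set e := expR (- (gamma * c0 ^+ 3 * t)).
have e2 : expR (- (2 * a * t)) = e ^+ 2.
  by rewrite /e expr2 -expRD /a; congr expR; ring.
(* the squares satisfy the inequality with the factor sqrt 3 <= 2 pi sqrt 3 *)
have bound : D ^+ 2 <= (2 * pi * Num.sqrt 3 * D0 * e + C * delta) ^+ 2.
  have pp : 0 < 2 * pi ^+ 2 :> R by rewrite mulr_gt0 ?exprn_gt0 ?pi_gt0.
  have h1 : D ^+ 2 <= 3 * D0 ^+ 2 * e ^+ 2 + C ^+ 2 * delta ^+ 2.
    apply: (le_trans up).
    have ipp : 0 <= (2 * pi ^+ 2)^-1 :> R by rewrite invr_ge0 ltW.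
    have := ler_wpM2l ipp decay; rewrite e2 mulrDr mulrA => h.
    have h2 := ler_wpM2r (sqr_ge0 e) low.
    have -> : C ^+ 2 * delta ^+ 2 = 3 * ((2 * pi ^+ 2)^-1 * (K / (2 * a))).
      rewrite (sqr_sqrtr (ltW C0)) KE; apply: forcing_constant.
      - by rewrite gt_eqF.
      - by rewrite gt_eqF.
      - exact: pi_neq0.
    by lra.
  apply: (le_trans h1).
  have s3 : 0 <= Num.sqrt 3 :> R by exact: sqrtr_ge0.
  have p1 : 1 <= 2 * pi :> R by have := pi_ge2 R; lra.
  have X0 : 0 <= 2 * pi * Num.sqrt 3 * D0 * e.
    by rewrite !mulr_ge0 ?pi_ge0 ?expR_ge0.
  have Y0 : 0 <= C * delta by rewrite mulr_ge0 ?sqrtr_ge0 ?(ltW de0).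
  have h3 : 3 * D0 ^+ 2 * e ^+ 2 <= (2 * pi * Num.sqrt 3 * D0 * e) ^+ 2.
    have -> : (2 * pi * Num.sqrt 3 * D0 * e) ^+ 2 =
      (2 * pi) ^+ 2 * (3 * D0 ^+ 2 * e ^+ 2).
      by rewrite 3!exprMn (sqr_sqrtr (ler0n R 3)); ring.
    have De : 0 <= 3 * D0 ^+ 2 * e ^+ 2.
      by rewrite mulr_ge0 ?sqr_ge0// mulr_ge0 ?sqr_ge0.
    by rewrite ler_peMl// exprn_ege1.
  rewrite -exprMn sqrrD; apply: lerD => //.
  by rewrite (le_trans h3)// lerDl mulrn_wge0// mulr_ge0.
have R0 : 2 * pi * Num.sqrt 3 * D0 * e + C * delta \is Num.nneg.
  rewrite nnegrE;
  by rewrite addr_ge0 ?mulr_ge0 ?pi_ge0 ?expR_ge0 ?sqrtr_ge0 ?(ltW de0).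
have Dn : D \is Num.nneg by rewrite nnegrE; exact: sqrtr_ge0.
by move: bound; rewrite (ler_sqr Dn R0).
Qed.
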